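(* Let $x,y,z_1,z_2$ be indeterminates, and take $Z_0(x,y)=1$. For every integer $n\ge 2$, the adjacent-boundary doubly-refined ASM generating functions can be expressed (as identities of rational functions) as $$Z^{\mathrm{adj}}_n(x,y;z_1,z_2)=Z_{n-1}(x,y)\,\biggl(1+\sum_{i=1}^{n-1}\biggl(\frac{y\,z_1z_2}{(z_1-1)(z_2-1)}\biggr)^{n-i}\biggl(1+\frac{(x(z_1-1)(z_2-1)-y)\,Z_i(x,y;z_1)\,Z_i(x,y;z_2)}{y\,Z_{i-1}(x,y)\,Z_i(x,y)}\biggr)\biggr)$$ and $$\begin{aligned}\widetilde{Z}^{\mathrm{adj}}_n(x,y;z_1,z_2)=Z_{n-1}(x,y)\,\biggl(&(xz_1z_2)^{n-1}+\sum_{i=1}^{n-1}\biggl(\frac{y}{(z_1-1)(z_2-1)}\biggr)^{n-i}\times\\ &\biggl(x^{i-1}(z_1z_2)^{n-1}+\frac{(z_1z_2)^{n-i-1}\bigl((z_1-1)(z_2-1)-yz_1z_2\bigr)\,Z_i(x,y;z_1)\,Z_i(x,y;z_2)}{y\,Z_{i-1}(x,y)\,Z_i(x,y)}\biggr)\biggr).\end{aligned}$$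
   Context: An alternating sign matrix (ASM) is a square matrix with entries in $\{0,1,-1\}$ such that along each row and each column the nonzero entries alternate in sign and sum to $1$. $\mathrm{ASM}(n)$ is the set of $n\times n$ ASMs. The first and last rows and columns of an ASM each contain exactly one $1$, all other entries there being $0$. For $A\in\mathrm{ASM}(n)$ define: $\nu(A)=\sum_{1\le i<i'\le n,\;1\le j'\le j\le n}A_{ij}A_{i'j'}$ (a nonnegative integer); $\mu(A)=$ number of $-1$'s in $A$; $\rho_{\mathrm T}(A)=$ number of $0$'s to the left of the $1$ in the top row; $\rho_{\mathrm R}(A)=$ number of $0$'s below the $1$ in the right-most column; $\rho_{\mathrm L}(A)=$ number of $0$'s above the $1$ in the left-most column. Generating functions (for $n\ge1$): $Z^{\mathrm{adj}}_n(x,y;z_1,z_2)=\sum_{A\in\mathrm{ASM}(n)}x^{\nu(A)}y^{\mu(A)}z_1^{\rho_{\mathrm T}(A)}z_2^{\rho_{\mathrm L}(A)}$; $\widetilde{Z}^{\mathrm{adj}}_n(x,y;z_1,z_2)=\sum_{A\in\mathrm{ASM}(n)}x^{\nu(A)}y^{\mu(A)}z_1^{\rho_{\mathrm T}(A)}z_2^{\rho_{\mathrm R}(A)}$; $Z_n(x,y;z)=\sum_{A\in\mathrm{ASM}(n)}x^{\nu(A)}y^{\mu(A)}z^{\rho_{\mathrm T}(A)}$; $Z_n(x,y)=\sum_{A\in\mathrm{ASM}(n)}x^{\nu(A)}y^{\mu(A)}$. *)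

(* Defs.v *)
From HB Require Import structures.
From mathcomp Require Import all_boot all_order all_algebra.
From mathcomp Require Import mpoly.

Set Implicit Arguments.
Unset Strict Implicit.
Unset Printing Implicit Defensive.

Import Order.TTheory GRing.Theory Num.Theory.
Local Open Scope ring_scope.

(* The entries are drawn from a finite subtype of int, so that the n x n
   matrices over it form a finType over which sums can be taken. *)
Definition asm_entry := seq_sub [:: 0; 1; -1 : int].

Definition int_mx n (M : 'M[asm_entry]_n) : 'M[int]_n := map_mx val M.

Definition alternating (s : seq int) : bool :=
  sorted (fun a b : int => a * b < 0) [seq a <- s | a != 0].

Definition row_seq n (A : 'M[int]_n) (i : 'I_n) : seq int :=
  [seq A i j | j <- enum 'I_n].

Definition asm_row n (A : 'M[int]_n) (i : 'I_n) : bool :=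
  alternating (row_seq A i) && (\sum_(j < n) A i j == 1).

Definition is_asm n (A : 'M[int]_n) : bool :=
  [forall i, asm_row A i] && [forall j, asm_row A^T j].

Definition ASM n : {set 'M[asm_entry]_n} := [set M | is_asm (int_mx M)].

Definition nu n (A : 'M[int]_n) : int :=
  \sum_(i < n) \sum_(i' < n | (i < i')%N)
    \sum_(j < n) \sum_(j' < n | (j' <= j)%N) A i j * A i' j'.

Definition mu n (A : 'M[int]_n) : nat :=
  #|[set p : 'I_n * 'I_n | A p.1 p.2 == -1]|.

(* Rows and columns are numbered from 0: the top row and the left-most column
   have index 0, the right-most column has index n - 1. *)
Definition rhoT n (A : 'M[int]_n) : nat :=
  #|[set j : 'I_n | [exists i : 'I_n, exists k : 'I_n,
      [&& (i == 0 :> nat)%N, A i j == 0, A i k == 1 & (j < k)%N]]]|.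

Definition rhoR n (A : 'M[int]_n) : nat :=
  #|[set i : 'I_n | [exists j : 'I_n, exists k : 'I_n,
      [&& (j.+1 == n)%N, A i j == 0, A k j == 1 & (k < i)%N]]]|.

Definition rhoL n (A : 'M[int]_n) : nat :=
  #|[set i : 'I_n | [exists j : 'I_n, exists k : 'I_n,
      [&& (j == 0 :> nat)%N, A i j == 0, A k j == 1 & (i < k)%N]]]|.

Section GeneratingFunctions.
Variable F : fieldType.
Implicit Types x y z : F.

(* nu is integer-valued, so x ^ nu A is an integer power. *)
Definition Zadj n x y z1 z2 : F :=
  \sum_(M in ASM n) let A := int_mx M in
    x ^ nu A * y ^+ mu A * z1 ^+ rhoT A * z2 ^+ rhoL A.

Definition Zadj_tilde n x y z1 z2 : F :=
  \sum_(M in ASM n) let A := int_mx M in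
    x ^ nu A * y ^+ mu A * z1 ^+ rhoT A * z2 ^+ rhoR A.

Definition Zref n x y z : F :=
  \sum_(M in ASM n) let A := int_mx M in
    x ^ nu A * y ^+ mu A * z ^+ rhoT A.

Definition Z n x y : F :=
  \sum_(M in ASM n) let A := int_mx M in x ^ nu A * y ^+ mu A.

(* The convention Z_0 = 1: the empty matrix is the only element of ASM 0. *)
Lemma Z0 x y : Z 0 x y = 1.
Proof.
pose M0 : 'M[asm_entry]_0 := \matrix_(i, j) SeqSub (mem_head 0 [:: 1; -1]).
have uniqM (M : 'M[asm_entry]_0) : M = M0 by apply/matrixP => -[].
have mu0 (A : 'M[int]_0) : mu A = 0%N by apply: eq_card0 => -[[]].
rewrite /Z (big_pred1 M0) => [|M]; first by rewrite /nu big_ord0 expr0z mu0 mul1r.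
rewrite inE (uniqM M) /= eqxx; apply/andP; by split; apply/forallP => -[].
Qed.

End GeneratingFunctions.

(* The field of rational functions in four indeterminates over the rationals. *)
Definition ratfun : fieldType := {fraction {mpoly rat[4]}}.

Definition indet (k : 'I_4) : ratfun := tofrac ('X_k : {mpoly rat[4]}).

(* Main.v *)
Require Import Defs.
From mathcomp Require Import all_boot all_order all_algebra.
From mathcomp Require Import ring zify.
From mathcomp Require Import mpoly.

Set Implicit Arguments.
Unset Strict Implicit.
Unset Printing Implicit Defensive.

Import Order.TTheory GRing.Theory Num.Theory.
Local Open Scope ring_scope.

(* The generating functions are partition functions of the six-vertex model with
   domain wall boundary. The bulk weights (x, 1, 1, 1, 1, y) extend to a family
   of weights that is rational in a parameter p for each row and a parameter w
   for each column, with bulk values p = 1 and w = 0, and that satisfies the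
   Yang-Baxter equation. Hence the partition function is symmetric in the w's;
   its values at the zeros of the weights in the first row are smaller partition
   functions, and Lagrange interpolation gives the Izergin-Korepin determinant.
   The Desnanot-Jacobi identity for this determinant is a bilinear relation
   without singularity at the bulk point. Keeping free only the parameters p of
   the first row and w of the first column, which encode z1 and z2, it becomes
     (z1 - 1)(z2 - 1) Z_(n-1) (Zadj_(n+1) - Z_n) =
       z1 z2 (y Z_n Zadj_n + (x (z1 - 1)(z2 - 1) - y) Z_n(z1) Z_n(z2)),
   and the formula for Zadj follows by telescoping. Reflecting matrices left to
   right replaces (x, y, z1, z2) by (1/x, y/x, 1/z1, 1/z2) and gives the formula
   for the other pair of boundaries. *)

(** * The six-vertex model *)

(** The determinant cannot be used directly at the bulk point, where its rows and columns coincide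
    and the Vandermonde products vanish. In the Desnanot-Jacobi identity, however, the three
    products of two partition functions carry the same differences, up to a factor (p' - p)(w - w')
    in one of them. After cancellation the relation is polynomial in all parameters and survives
    coincidences. The cancellation needs generic parameters, which are reached by moving each one
    along a line of its own slope. The smallest partition function must be nonzero, because it
    stands for the block whose Schur complement is taken. The corner is a second obstacle. An entry
    0 of type A2 there counts for both boundary statistics and needs the weight z1 z2, whereas the
    deformed model gives it p - w. The partition function is affine in this weight, and its constant
    term is known: a 1 in the corner leaves an ASM of smaller order. Hence the difference Zadj_(n+1)
    - Z_n, which is proportional to the unknown coefficient. *)

(* At an entry of an alternating sign matrix, let V be the sum of the entries
   above it and H the sum of those to its left. The entries 1 and -1 are of type
   C1 and C2; an entry 0 is of type A1, A2, B1 or B2 if (V, H) is (1, 1), (0, 0),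
   (1, 0) or (0, 1), and then V and H do not change across it. *)
Variant vertex := VA1 | VA2 | VB1 | VB2 | VC1 | VC2.

Section SixVertex.
Variable F : comNzRingType.
Implicit Types (u : vertex -> F) (us : seq (vertex -> F)) (h : bool).
Implicit Types (s t : seq bool) (G : seq bool -> F).

(* [s] lists the vertical edges above a row, [h] is its left edge and its right
   edge is 1; the states below the row are summed out against [G]. *)
Fixpoint row_op us h G s : F :=
  match us, s with
  | [::], [::] => if h then G [::] else 0
  | u :: us', a :: s' =>
    let stay := row_op us' h (G \o cons a) s' in
    match a, h with
    | false, false => u VA2 * stay + u VC1 * row_op us' true (G \o cons true) s'
    | true, true => u VA1 * stay + u VC2 * row_op us' false (G \o cons false) s'
    | true, false => u VB1 * stay
    | false, true => u VB2 * stay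
    end
  | _, _ => 0
  end.

Fixpoint state_sum rows s : F :=
  if rows is us :: rows' then row_op us false (state_sum rows') s
  else (all id s)%:R.

Lemma eq_row_op us h G G' s : G =1 G' -> row_op us h G s = row_op us h G' s.
Proof.
elim: us h G G' s => [|u us IH] h G G' [|a s] //= eG; first by rewrite eG.
have eGc b : G \o cons b =1 G' \o cons b by move=> t /=; rewrite eG.
by case: a; case: h; rewrite !(IH _ _ _ _ (eGc _)).
Qed.

Lemma row_op_lin us h c d G G' s :
  row_op us h (fun t => c * G t + d * G' t) s =
  c * row_op us h G s + d * row_op us h G' s.
Proof.
elim: us h G G' s => [|u us IH] h G G' [|a s] //=; try by ring.
  by case: h => //; ring.
have IHc b k : row_op us k ((fun t => c * G t + d * G' t) \o cons b) s =
  c * row_op us k (G \o cons b) s + d * row_op us k (G' \o cons b) s.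
  by rewrite -IH; apply: eq_row_op.
by case: a; case: h; rewrite !IHc; ring.
Qed.

Lemma row_opZ us h c G s :
  row_op us h (fun t => c * G t) s = c * row_op us h G s.
Proof.
transitivity (row_op us h (fun t => c * G t + 0 * G t) s).
  by apply: eq_row_op => t; ring.
by rewrite row_op_lin; ring.
Qed.

(** With V = 0 above and H = 1 on the left only B2 fits, and it passes H = 1 on: the whole row is
    frozen. *)
Lemma row_op_top us G :
  row_op us true G (nseq (size us) false) =
  (\prod_(u <- us) u VB2) * G (nseq (size us) false).
Proof.
elim: us G => [|u us IH] G /=; first by rewrite big_nil mul1r.
by rewrite big_cons IH mulrA.
Qed.

(** With V = 1 and H = 0 the vertex must be B1, which passes V = 1 down and leaves H = 0 for the
    next column. *)
Lemma state_sum_first_col rows s :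
  state_sum [seq r.1 :: r.2 | r <- rows] (true :: s) =
  (\prod_(r <- rows) r.1 VB1) * state_sum [seq r.2 | r <- rows] s.
Proof.
elim: rows s => [|[u us] rows IH] s /=; first by rewrite big_nil mul1r.
rewrite big_cons /= -mulrA; congr (_ * _); rewrite -row_opZ.
by apply: eq_row_op => t /=; rewrite IH.
Qed.

(** A corner with V = H = 0 is A2 or C1. A C1 forces B2 along the rest of the row and B1 down the
    rest of the column, so the second summand is a smaller partition function. *)
Lemma state_sum_corner u us rows :
  state_sum ((u :: us) :: [seq r.1 :: r.2 | r <- rows])
      (nseq (size us).+1 false) =
  u VA2 * row_op us false
    (state_sum [seq r.1 :: r.2 | r <- rows] \o cons false)
    (nseq (size us) false)
  + u VC1 * ((\prod_(v <- us) v VB2) * (\prod_(r <- rows) r.1 VB1) *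
     state_sum [seq r.2 | r <- rows] (nseq (size us) false)).
Proof. by rewrite /= row_op_top /= state_sum_first_col !mulrA. Qed.

(** The right edge of a row is 1. Below V = 1, the types B1 and C2 would leave H = 0, so the last
    vertex can only be A1. *)
Lemma row_op_last us u h G s : size s = size us ->
  row_op (rcons us u) h G (rcons s true) =
  u VA1 * row_op us h (G \o rcons^~ true) s.
Proof.
elim: us h G s => [|v us IH] h G [|a s] //=.
  by move=> _; case: h; rewrite ?mulr0 ?addr0.
move=> [/IH {}IH].
have IHc b k : row_op (rcons us u) k (G \o cons b) (rcons s true) =
  u VA1 * row_op us k ((G \o rcons^~ true) \o cons b) s.
  by rewrite IH; congr (_ * _); apply: eq_row_op.
by case: a; case: h; rewrite !IHc; ring.
Qed.

Lemma eq_row_op_size us h G G' s :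
  (forall t, size t = size us -> G t = G' t) ->
  row_op us h G s = row_op us h G' s.
Proof.
elim: us h G G' s => [|u us IH] h G G' [|a s] //= eG; first by rewrite eG.
have eGc b k : row_op us k (G \o cons b) s = row_op us k (G' \o cons b) s.
  by apply: IH => t st /=; rewrite eG //= st.
by case: a; case: h; rewrite !eGc.
Qed.

Lemma state_sum_last_col n rows s :
  all (fun r => size r.2 == n) rows -> size s = n ->
  state_sum [seq rcons r.2 r.1 | r <- rows] (rcons s true) =
  (\prod_(r <- rows) r.1 VA1) * state_sum [seq r.2 | r <- rows] s.
Proof.
elim: rows s => [|[u us] rows IH] s /=.
  by rewrite big_nil all_rcons mul1r.
move=> /andP[/eqP ssz rows_n] ss; rewrite big_cons /= -mulrA.
rewrite row_op_last ?ssz //; congr (_ * _).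
rewrite -row_opZ; apply: eq_row_op_size => t st /=.
by rewrite IH // st.
Qed.

(** If the C1 of the top row were further left, B2 would follow up to the last column, where its
    weight vanishes. *)
Lemma row_op_frozen_right us u G : u VB2 = 0 ->
  row_op (rcons us u) false G (nseq (size us).+1 false) =
  (\prod_(v <- us) v VA2) * (u VC1 * G (rcons (nseq (size us) false) true)).
Proof.
move=> u0; elim: us G => [|v us IH] G /=.
  by rewrite big_nil mulr0 add0r mul1r.
have := row_op_top (rcons us u) (G \o cons true).
rewrite size_rcons big_cons IH => ->.
by rewrite big_rcons /= u0 mulr0 mul0r mulr0 addr0 mulrA.
Qed.

End SixVertex.

(** * Inhomogeneous weights and the Yang-Baxter equation *)

Section YangBaxter.
Variables (F : fieldType) (x y : F).
Implicit Types (p w : F) (ps ws : seq F) (s t : seq bool) (G : seq bool -> F).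

(* With a = wt_a p w and b = wt_b p w,
     wt_c p * wt_c w = x a^2 - (x + 1 - y) a b + b^2,
   so that all pairs (p, w) share the invariant of the bulk weights. *)
Definition wt_a p w := p - w.
Definition wt_b p w := 1 + w * (x * p - (x + 1 - y)).
Definition wt_c w := x * w ^+ 2 - (x + 1 - y) * w + 1.

(** Each row of a configuration has one C1 more than C2, so up to a global factor only the product
    of the two weights matters. Placing it all on C2 avoids square roots and keeps the top row,
    which has no C2, of low degree in [p]. *)
Definition weight p w (v : vertex) : F :=
  match v with
  | VA1 => x * wt_a p w
  | VA2 => wt_a p w
  | VB1 | VB2 => wt_b p w
  | VC1 => 1
  | VC2 => wt_c p * wt_c w
  end.

Definition weights ps ws := [seq [seq weight p w | w <- ws] | p <- ps].

Definition Zinhom ps ws : F :=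
  state_sum (weights ps ws) (nseq (size ws) false).

(* The R-matrix exchanging the parameters of columns [k] and [k + 1] *)
Fixpoint Rmx k w w' G s : F :=
  match k, s with
  | 0, a :: b :: t =>
    match a, b with
    | false, true => wt_c w' * G [:: false, true & t]
                     + x * (w - w') * G [:: true, false & t]
    | true, false => (w - w') * G [:: false, true & t]
                     + wt_c w * G [:: true, false & t]
    | _, _ => wt_b w w' * G s
    end
  | k'.+1, a :: t => Rmx k' w w' (G \o cons a) t
  | _, _ => 0
  end.

Lemma eq_Rmx k w w' G G' s : G =1 G' -> Rmx k w w' G s = Rmx k w w' G' s.
Proof.
elim: k G G' s => [|k IH] G G' [|a s] //= eG.
  by case: s => // b s; rewrite !eG.
by apply: IH => t /=; rewrite eG.
Qed.

Lemma Rmx_lin k w w' c d G G' s :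
  Rmx k w w' (fun t => c * G t + d * G' t) s =
  c * Rmx k w w' G s + d * Rmx k w w' G' s.
Proof.
elim: k G G' s => [|k IH] G G' [|a s] //=; try by ring.
  by case: s => [|b s]; case: a => //; try case: b; ring.
by rewrite -IH; apply: eq_Rmx.
Qed.

Lemma RmxZ k w w' c G s :
  Rmx k w w' (fun t => c * G t) s = c * Rmx k w w' G s.
Proof.
transitivity (Rmx k w w' (fun t => c * G t + 0 * G t) s).
  by apply: eq_Rmx => t; ring.
by rewrite Rmx_lin; ring.
Qed.

(** Columns to the left of the pair carry the identity along by linearity. At the pair itself the
    eight choices of [(a, b, h)] give polynomial identities, with the outcomes of the remaining
    columns as unknowns. *)
Lemma yang_baxter p l w w' r h G s :
  size s = (size l + (size r).+2)%N ->
  row_op [seq weight p v | v <- l ++ w :: w' :: r] h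
    (Rmx (size l) w w' G) s =
  Rmx (size l) w w'
    (row_op [seq weight p v | v <- l ++ w' :: w :: r] h G) s.
Proof.
elim: l h G s => [|v l IH] h G s /=.
  case: s => [|a [|b s]] //= _.
  set us := map _ r.
  have rR k a' b' : row_op us k ((Rmx 0 w w' G \o cons a') \o cons b') s =
    match a', b' with
    | false, true =>
      wt_c w' * row_op us k ((G \o cons false) \o cons true) s
      + x * (w - w') * row_op us k ((G \o cons true) \o cons false) s
    | true, false =>
      (w - w') * row_op us k ((G \o cons false) \o cons true) s
      + wt_c w * row_op us k ((G \o cons true) \o cons false) s
    | _, _ => wt_b w w' * row_op us k ((G \o cons a') \o cons b') s
    end.
    by case: a'; case: b'; rewrite -?row_op_lin -?row_opZ.
  by case: a; case: b; case: h; rewrite !rR /wt_a /wt_b /wt_c; ring.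
case: s => [|a s] //= [ss].
have IHc b k : row_op [seq weight p v0 | v0 <- l ++ [:: w, w' & r]] k
    (Rmx (size l).+1 w w' G \o cons b) s =
  Rmx (size l) w w' (row_op [seq weight p v0 | v0 <- l ++ [:: w', w & r]] k
    (G \o cons b)) s by rewrite -IH //; apply: eq_row_op.
case: a; case: h; rewrite !IHc -?Rmx_lin -?RmxZ; exact: eq_Rmx.
Qed.

Lemma Rmx_true k w w' s : (k.+2 <= size s)%N ->
  Rmx k w w' (fun t => (all id t)%:R) s = wt_b w w' * (all id s)%:R.
Proof.
elim: k s => [|k IH] [|a s] //=.
  case: s => [|b s] //= _; case: a; case: b => /=; ring.
rewrite ltnS => /IH {}IH; case: a; last first.
  rewrite (eq_Rmx _ _ _ _ (G' := fun t => 0 * (all id t)%:R)) ?RmxZ ?IH.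
    by rewrite !mulr0 mul0r.
  by move=> t /=; rewrite mul0r.
by rewrite -IH; exact: eq_Rmx.
Qed.

Lemma Rmx_false k w w' G n : (k.+2 <= n)%N ->
  Rmx k w w' G (nseq n false) = wt_b w w' * G (nseq n false).
Proof.
elim: k n G => [|k IH] [|n] G //=; first by case: n.
by rewrite ltnS => /IH ->.
Qed.

(** The R-matrix travels upwards one row at a time. It starts below the last row, where all edges
    are 1 and it is the scalar [wt_b w w']. *)
Lemma state_sum_swap ps l w w' r s : size s = (size l + (size r).+2)%N ->
  wt_b w w' * state_sum (weights ps (l ++ w :: w' :: r)) s =
  Rmx (size l) w w' (state_sum (weights ps (l ++ w' :: w :: r))) s.
Proof.
elim: ps s => [|p ps IH] s ss /=.
  by rewrite Rmx_true // ss -addn2 leq_add.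
rewrite -row_opZ -yang_baxter //; apply: eq_row_op_size => t st.
by rewrite IH // st size_map size_cat.
Qed.

(** Above the first row all edges are 0 and the R-matrix is again the scalar [wt_b w w'], which
    cancels. *)
Lemma Zinhom_swap ps l w w' r : wt_b w w' != 0 ->
  Zinhom ps (l ++ w :: w' :: r) = Zinhom ps (l ++ w' :: w :: r).
Proof.
move=> nz; apply: (mulfI nz); rewrite /Zinhom state_sum_swap; last first.
  by rewrite size_nseq size_cat.
by rewrite Rmx_false !size_cat //= -addn2 leq_add.
Qed.

Lemma Zinhom_front ps l w r : all (fun u => wt_b u w != 0) l ->
  Zinhom ps (l ++ w :: r) = Zinhom ps (w :: l ++ r).
Proof.
elim/last_ind: l r => [|l u IH] r //; rewrite all_rcons => /andP[nz /IH {}IH].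
by rewrite cat_rcons Zinhom_swap // IH cat_rcons.
Qed.

Lemma Zinhom_back ps l w r : all (fun u => wt_b w u != 0) r ->
  Zinhom ps (l ++ w :: r) = Zinhom ps (rcons (l ++ r) w).
Proof.
elim: r l => [|u r IH] l /=; first by rewrite cats1 cats0.
move=> /andP[nz /IH {}IH].
by rewrite Zinhom_swap // -cat_rcons IH cat_rcons.
Qed.

(** A corner A2 has weight 0, so the corner is C1 and freezes the first row and column. *)
Lemma Zinhom_left p ps w ws : wt_a p w = 0 ->
  Zinhom (p :: ps) (w :: ws) =
  (\prod_(u <- ws) wt_b p u) * (\prod_(q <- ps) wt_b q w) * Zinhom ps ws.
Proof.
move=> a0; have wE : weights ps (w :: ws) =
    [seq r.1 :: r.2 | r <- [seq (weight q w, [seq weight q u | u <- ws])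
                           | q <- ps]].
  by rewrite -map_comp.
have := state_sum_corner (weight p w) [seq weight p u | u <- ws]
  [seq (weight q w, [seq weight q u | u <- ws]) | q <- ps].
rewrite -wE size_map /Zinhom /= => ->.
by rewrite a0 mul0r add0r mul1r !big_map -map_comp.
Qed.

(** The 1 of the top row is forced into the last column, with A2 to its left and A1 below it. *)
Lemma Zinhom_right p ps w ws : wt_b p w = 0 ->
  Zinhom (p :: ps) (rcons ws w) =
  (\prod_(u <- ws) wt_a p u) * (\prod_(q <- ps) (x * wt_a q w)) * Zinhom ps ws.
Proof.
move=> b0.
have wE : weights ps (rcons ws w) =
    [seq rcons r.2 r.1 | r <- [seq (weight q w, [seq weight q u | u <- ws])
                           | q <- ps]].
  by rewrite -map_comp; apply: eq_map => q /=; rewrite map_rcons.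
rewrite /Zinhom /= map_rcons size_rcons.
have := @row_op_frozen_right _ [seq weight p u | u <- ws] (weight p w)
  (state_sum (weights ps (rcons ws w))) b0.
rewrite size_map => ->; rewrite wE (@state_sum_last_col _ (size ws)).
- by rewrite /= !big_map -map_comp mul1r mulrA.
- by rewrite all_map; apply/allP => q _ /=; rewrite size_map.
- by rewrite size_nseq.
Qed.

End YangBaxter.

(** * The Izergin-Korepin determinant *)

Definition del (T : Type) j (s : seq T) := take j s ++ drop j.+1 s.

Lemma size_del (T : Type) j (s : seq T) : (j < size s)%N ->
  size (del j s) = (size s).-1.
Proof. by move=> js; rewrite size_cat size_takel ?size_drop; lia. Qed.

Lemma nth_del (T : Type) x0 j (s : seq T) k : (j <= size s)%N ->
  nth x0 (del j s) k = nth x0 s (bump j k).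
Proof.
move=> js; rewrite nth_cat size_takel // /bump; case: ltnP => kj.
  by rewrite nth_take // leqNgt kj.
by rewrite nth_drop; congr nth; lia.
Qed.

Lemma split_del (T : Type) x0 j (s : seq T) : (j < size s)%N ->
  s = take j s ++ nth x0 s j :: drop j.+1 s.
Proof. by move=> js; rewrite -drop_nth // cat_take_drop. Qed.

Lemma mem_del (T : eqType) x0 j i (s : seq T) :
  (i < size s)%N -> (j < size s)%N -> i != j -> nth x0 s i \in del j s.
Proof.
move=> si sj ij; apply/(nthP x0); exists (unbump j i); last first.
  by rewrite nth_del ?(ltnW sj) // unbumpK.
by rewrite size_del // /unbump; lia.
Qed.

Lemma uniq_del (T : eqType) x0 j (s : seq T) : (j < size s)%N ->
  uniq s -> (uniq (del j s)) && (nth x0 s j \notin del j s).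
Proof.
move=> js; rewrite {1}(split_del x0 js) -cat1s uniq_catCA /=.
by case/andP => -> ->.
Qed.

(** * Lagrange interpolation in the parameter of the first row *)

Section Interpolation.
Variables (F : fieldType) (x y : F).
Implicit Types (p w : F) (ps ws : seq F) (G : seq bool -> F).
Local Notation wtb := (wt_b x y).
Local Notation Zin := (Zinhom x y).
Local Notation wgt := (weight x y).

Lemma horner_wt_b w p :
  wtb p w = (1 + w *: (x *: 'X - (x + 1 - y)%:P)).[p].
Proof. by rewrite !hornerE. Qed.

Lemma size_wt_b w : (size (1 + w *: (x *: 'X - (x + 1 - y)%:P))%R <= 2)%N.
Proof.
have s1 (c : F) : (size c%:P <= 2)%N by apply: leq_trans (size_polyC_leq1 _) _.
apply: leq_trans (size_polyD _ _) _; rewrite geq_max s1 /=.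
apply: leq_trans (size_scale_leq _ _) _.
apply: leq_trans (size_polyD _ _) _; rewrite geq_max size_polyN s1 andbT.
by apply: leq_trans (size_scale_leq _ _) _; rewrite size_polyX.
Qed.

Lemma size_prod_leq d (I : Type) (r : seq I) (f : I -> {poly F}) :
  (forall i, size (f i) <= d.+1)%N ->
  (size (\prod_(i <- r) f i)%R <= (d * size r).+1)%N.
Proof.
move=> fd; elim: r => [|i r IH]; first by rewrite big_nil size_poly1.
rewrite big_cons; apply: leq_trans (size_polyMleq _ _) _.
by have := fd i; move: IH => /=; nia.
Qed.

(* In the top row of a domain wall configuration there is a single vertex of
   type C, so its wgt has degree at most [size ws - 1] in [p]. *)
Lemma row_op_poly ws G : exists2 q : {poly F}, (size q <= size ws)%N &
  forall p, row_op [seq wgt p w | w <- ws] false G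
              (nseq (size ws) false) = q.[p].
Proof.
elim: ws G => [|w ws IH] G /=.
  by exists 0; rewrite ?size_poly0 // => p; rewrite horner0.
have [q sq qE] := IH (G \o cons false).
pose b := \prod_(u <- ws) (1 + u *: (x *: 'X - (x + 1 - y)%:P)).
pose c := (G \o cons true) (nseq (size ws) false).
exists (('X - w%:P) * q + c *: b) => [|p].
  apply: leq_trans (size_polyD _ _) _; rewrite geq_max; apply/andP; split.
    by apply: leq_trans (size_polyMleq _ _) _; rewrite size_XsubC /=.
  apply: leq_trans (size_scale_leq _ _) _.
  by rewrite -(mul1n (size ws)); exact/size_prod_leq/size_wt_b.
have := row_op_top [seq wgt p u | u <- ws] (G \o cons true).
rewrite qE size_map => ->; rewrite -/c big_map /= !hornerE horner_prod.
by rewrite [c * _]mulrC; under eq_bigr do rewrite horner_wt_b.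
Qed.

(** Up to weights and Vandermonde factors, this is a term of the expansion of the determinant along
    the row of [p]. As a polynomial in [p] it vanishes at the zeros of both weights of every column
    but the one with index [j]. *)
Definition interp_term ps ws p j :=
  \prod_(u <- del j ws) (wt_a p u * wtb p u / (ws`_j - u)) *
  \prod_(q <- ps) (wt_a q ws`_j * wtb q ws`_j) * Zin ps (del j ws).

Lemma interp_term0 ps ws p j i :
  (i < size ws)%N -> (j < size ws)%N -> i != j ->
  wt_a p ws`_i * wtb p ws`_i = 0 -> interp_term ps ws p j = 0.
Proof.
move=> si sj ij ab0; rewrite /interp_term.
rewrite (perm_big _ (perm_to_rem (mem_del 0 si sj ij))) big_cons.
by rewrite ab0 /= !mul0r.
Qed.

(** These conditions make the nodes exist and differ: [x] and [w] nonzero give [wt_b] a root in [p],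
    and [wtb u w != 0], also for [u = w], separates the zeros of a from those of b. The last
    condition also lets the scalar of the R-matrix cancel. *)
Definition interpolable ws :=
  [/\ x != 0, uniq ws, 0 \notin ws &
      {in ws &, forall u w, wtb u w != 0}].

Lemma interp_at_a ps ws j : interpolable ws -> (j < size ws)%N ->
  Zin (ws`_j :: ps) ws * \prod_(q <- ps) (q - ws`_j) =
  interp_term ps ws ws`_j j.
Proof.
move=> [_ uw _ bnz] js; set w := ws`_j.
have ww : w \in ws by apply: mem_nth.
have [ud wd] := andP (uniq_del 0 js uw).
have sub u : u \in del j ws -> u \in ws.
  by rewrite {2}(split_del 0 js) !mem_cat inE => /orP[]->; rewrite ?orbT.
rewrite {1}(split_del 0 js) Zinhom_front; last first.
  apply/allP => u ud'; apply: bnz => //; apply: sub.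
  by rewrite mem_cat ud'.
rewrite Zinhom_left; last by rewrite /wt_a subrr.
rewrite /interp_term -/w -/(del j ws) [X in _ = X * _ * _](_ : _ =
  \prod_(u <- del j ws) wtb w u); last first.
  apply: eq_big_seq => u uD; rewrite mulrAC mulfV ?mul1r // subr_eq0.
  by apply: contraNneq wd => wu; rewrite -/w wu.
by rewrite big_split /= /wt_a; ring.
Qed.

Definition b_root w := ((x + 1 - y) * w - 1) / (x * w).

Lemma wt_b_root w u : x != 0 -> w != 0 -> wtb (b_root w) u = (w - u) / w.
Proof. by move=> x0 w0; rewrite /b_root /wt_b; field; rewrite x0 w0. Qed.

Lemma interp_at_b ps ws j : interpolable ws -> size ws = (size ps).+1 ->
  (j < size ws)%N ->
  Zin (b_root ws`_j :: ps) ws * \prod_(q <- ps) (q - b_root ws`_j) =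
  interp_term ps ws (b_root ws`_j) j.
Proof.
move=> [x0 uw w0 bnz] ss js; set w := ws`_j.
have ww : w \in ws by apply: mem_nth.
have {}w0 : w != 0 by apply: contraNneq w0 => <-.
have [ud wd] := andP (uniq_del 0 js uw).
have sub u : u \in del j ws -> u \in ws.
  by rewrite {2}(split_del 0 js) !mem_cat inE => /orP[]->; rewrite ?orbT.
rewrite {1}(split_del 0 js) Zinhom_back; last first.
  apply/allP => u ud'; apply: bnz => //; apply: sub.
  by rewrite mem_cat ud' orbT.
rewrite Zinhom_right; last by rewrite wt_b_root // subrr mul0r.
rewrite /interp_term -/w -/(del j ws) [X in _ = X * _ * _](_ : _ =
  \prod_(u <- del j ws) (wt_a (b_root w) u * w^-1)); last first.
  apply: eq_big_seq => u uD; rewrite wt_b_root //; field; rewrite w0 subr_eq0.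
  by apply: contraNneq wd => wu; rewrite -/w wu.
(* One factor per remaining column against one per remaining row: the numbers agree because the
   lattice is square. *)
have pw : \prod_(u <- del j ws) w^-1 = \prod_(q <- ps) w^-1.
  by rewrite !big_const_seq !count_predT size_del // ss.
rewrite [in RHS]big_split /= {}pw.
(* Since [wtb q w = x * w * (q - b_root w)], the interpolation factor supplies the missing weights
   b. *)
have pE : \prod_(q <- ps) (x * wt_a q w) * \prod_(q <- ps) (q - b_root w) =
    \prod_(q <- ps) w^-1 * \prod_(q <- ps) (wt_a q w * wtb q w).
  rewrite -!big_split /=; apply: eq_bigr => q _.
  by rewrite /b_root /wt_b /wt_a; field; rewrite x0 w0.
by ring: pE.
Qed.

(* Both sides have degree at most 2N - 2 in [p], where N = size ws; they agree
   at the N zeros of the weights a and the N zeros of the weights b, where a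
   single term of the sum survives. *)
Lemma interpolation p ps ws : interpolable ws -> size ws = (size ps).+1 ->
  Zin (p :: ps) ws * \prod_(q <- ps) (q - p) =
  \sum_(j < size ws) interp_term ps ws p j.
Proof.
move=> iws ss; have [x0 uw w0 bnz] := iws.
have [q sq qE] := row_op_poly ws (state_sum (weights x y ps ws)).
pose b u := 1 + u *: (x *: 'X - (x + 1 - y)%:P).
pose lhs := q * \prod_(r <- ps) (r%:P - 'X).
pose rhs := \sum_(j < size ws)
   (\prod_(u <- del j ws) (('X - u%:P) * b u * ((ws`_j - u)^-1)%:P) *
    (\prod_(q <- ps) (wt_a q ws`_j * wtb q ws`_j) *
     Zin ps (del j ws))%:P).
have lhsE r : lhs.[r] = Zin (r :: ps) ws * \prod_(q <- ps) (q - r).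
  rewrite hornerM -qE horner_prod; congr (_ * _).
  by apply: eq_bigr => i _; rewrite !hornerE.
have rhsE r : rhs.[r] = \sum_(j < size ws) interp_term ps ws r j.
  rewrite horner_sum; apply: eq_bigr => j _.
  rewrite hornerM hornerC /interp_term -mulrA; congr (_ * _).
  rewrite horner_prod; apply: eq_bigr => u _.
  by rewrite !hornerM hornerC horner_wt_b hornerXsubC.
rewrite -lhsE -rhsE; congr _.[_]; apply/eqP; rewrite -subr_eq0.
have sXr (r : F) : (size (r%:P - 'X)%R <= 2)%N.
  by rewrite -size_polyN opprB size_XsubC.
have sl : (size (lhs - rhs)%R <= (size ws + size ws).-1)%N.
  apply: leq_trans (size_polyD _ _) _; rewrite size_polyN geq_max.
  apply/andP; split.
    apply: leq_trans (size_polyMleq _ _) _.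
    by have := size_prod_leq ps sXr; rewrite mul1n ss; move: sq; rewrite ss;
      lia.
  apply: leq_trans (size_sum _ _ _) _; apply/bigmax_leqP => j _.
  apply: leq_trans (size_polyMleq _ _) _.
  have size3 u : (size (('X - u%:P) * b u * ((ws`_j - u)^-1)%:P)%R <= 3)%N.
    have := size_polyMleq (('X - u%:P) * b u) ((ws`_j - u)^-1)%:P.
    have := size_polyMleq ('X - u%:P) (b u).
    have := size_polyC_leq1 ((ws`_j - u)^-1); have := size_wt_b u.
    have sX : size ('X - u%:P) = 2%N := size_XsubC u; rewrite sX -/(b u).
    move: (size _%:P) (size (_ * b u)) (size (b u)) => n1 n2 n3.
    by move: (size _) => n4; lia.
  have arith k m1 m2 m : (k < m)%N -> (m1 <= (2 * m.-1).+1)%N ->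
    (m2 <= 1)%N -> ((m1 + m2).-1 <= (m + m).-1)%N by lia.
  apply: (arith j _ _ _ (ltn_ord j)); last exact: size_polyC_leq1.
  by rewrite -(size_del (ltn_ord j)); exact: size_prod_leq.
apply: contraTT sl => nz; rewrite -ltnNge.
have := @max_poly_roots _ _ (ws ++ [seq b_root w | w <- ws]) nz.
rewrite size_cat size_map => rootsP.
suff: (size ws + size ws < size (lhs - rhs)%R)%N by lia.
apply: rootsP.
  rewrite all_cat; apply/andP; split.
    apply/allP => _ /(nthP 0)[j js <-].
    rewrite rootE hornerD hornerN subr_eq0 lhsE rhsE interp_at_a //.
    rewrite (bigD1 (Ordinal js)) //= big1 ?addr0 // => i ij.
    apply: (interp_term0 _ js) => //; first by rewrite eq_sym.
    by rewrite /wt_a subrr mul0r.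
  rewrite all_map; apply/allP => _ /(nthP 0)[j js <-] /=.
  rewrite rootE hornerD hornerN subr_eq0 lhsE rhsE interp_at_b //.
  rewrite (bigD1 (Ordinal js)) //= big1 ?addr0 // => i ij.
  apply: (interp_term0 _ js) => //; first by rewrite eq_sym.
  rewrite wt_b_root ?subrr ?mul0r ?mulr0 //.
  by apply: contraNneq w0 => <-; apply: mem_nth.
have nz0 w : w \in ws -> w != 0 by move=> ?; apply: contraNneq w0 => <-.
rewrite cat_uniq uw /=; apply/andP; split; last first.
  rewrite map_inj_in_uniq // => u w uu ww /(congr1 (wtb^~ u)).
  rewrite !(wt_b_root _ x0) ?(nz0 u) ?(nz0 w) // subrr mul0r => /esym/eqP.
  by rewrite mulf_eq0 invr_eq0 (negPf (nz0 w ww)) orbF subr_eq0 => /eqP.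
apply/hasPn => _ /mapP[w ww ->] /=; apply/negP => bw.
by have := bnz _ _ bw ww; rewrite (wt_b_root _ x0 (nz0 w ww)) subrr mul0r eqxx.
Qed.

End Interpolation.

Lemma prod_del (R : comNzRingType) (T : Type) x0 j (s : seq T) (f : T -> R) :
  (j < size s)%N ->
  \prod_(a <- s) f a = f (nth x0 s j) * \prod_(a <- del j s) f a.
Proof.
move=> js; rewrite {1}(split_del x0 js) !big_cat big_cons /=.
by rewrite mulrCA.
Qed.

(** * Schur complements and the Desnanot-Jacobi identity *)

Lemma det_block_schur (F : fieldType) k m (A : 'M[F]_k) B C (D : 'M_m) :
  D \in unitmx ->
  \det (block_mx A B C D) = \det (A - B *m invmx D *m C) * \det D.
Proof.
move=> uD; set S := A - _.
have -> : block_mx A B C D =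
    block_mx S (B *m invmx D) 0 1%:M *m block_mx 1%:M 0 C D.
  rewrite mulmx_block !mulmx1 !mul1mx !mulmx0 !add0r mulmxKV //.
  by rewrite subrK.
by rewrite det_mulmx det_ublock det_lblock !det1 mul1r mulr1.
Qed.

Lemma det2 (R : comNzRingType) (A : 'M[R]_2) :
  \det A = A 0 0 * A 1 1 - A 0 1 * A 1 0.
Proof.
rewrite (expand_det_row _ 0) !big_ord_recl big_ord0 /cofactor !det_mx11 !mxE /=.
rewrite expr0 expr1 addr0 mul1r mulN1r mulrN.
by congr (A _ _ * A _ _ - A _ _ * A _ _); apply: val_inj.
Qed.

Section KernelDet.
Variables (F : fieldType) (T : Type) (t0 : T) (k : T -> T -> F).

Definition kernel_mx n ps ws : 'M[F]_n :=
  \matrix_(i, j) k (nth t0 ps i) (nth t0 ws j).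

(* Desnanot-Jacobi, by taking Schur complements of the common block *)
Lemma det_kernel_jacobi m p p' ps w w' ws : \det (kernel_mx m ps ws) != 0 ->
  \det (kernel_mx m.+2 [:: p, p' & ps] [:: w, w' & ws]) *
    \det (kernel_mx m ps ws) =
  \det (kernel_mx m.+1 (p :: ps) (w :: ws)) *
    \det (kernel_mx m.+1 (p' :: ps) (w' :: ws)) -
  \det (kernel_mx m.+1 (p :: ps) (w' :: ws)) *
    \det (kernel_mx m.+1 (p' :: ps) (w :: ws)).
Proof.
rewrite -unitfE => uD; set D := kernel_mx m ps ws.
pose R q : 'rV_m := \row_j k q (nth t0 ws j).
pose C v : 'cV_m := \col_i k (nth t0 ps i) v.
pose s q v := k q v - (R q *m invmx D *m C v) 0 0.
have det1 q v : \det (kernel_mx m.+1 (q :: ps) (v :: ws)) = s q v * \det D.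
  have -> : kernel_mx m.+1 (q :: ps) (v :: ws) =
      block_mx (k q v)%:M (R q) (C v) D :> 'M_(1 + m).
    apply/matrixP => i j; rewrite -[i]splitK -[j]splitK.
    case: (split i) => a; case: (split j) => b /=;
      rewrite ?block_mxEul ?block_mxEur ?block_mxEdl ?block_mxEdr !mxE;
      by rewrite ?ord1 //= ?mulr1n.
  by rewrite (@det_block_schur _ 1 m) // det_mx11 /s !mxE mulr1n.
pose ps2 (i : 'I_2) := if i == 0 then p else p'.
pose ws2 (i : 'I_2) := if i == 0 then w else w'.
have -> : kernel_mx m.+2 [:: p, p' & ps] [:: w, w' & ws] =
    block_mx (\matrix_(i, j) k (ps2 i) (ws2 j)) (\matrix_(i, j) R (ps2 i) 0 j)
      (\matrix_(i, j) C (ws2 j) i 0) D :> 'M_(2 + m).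
  apply/matrixP => i j; rewrite -[i]splitK -[j]splitK.
  case: (split i) => a; case: (split j) => b /=;
    rewrite ?block_mxEul ?block_mxEur ?block_mxEdl ?block_mxEdr !mxE;
    rewrite /ps2 /ws2; try case: a => [[|[|a]] ai]; try case: b => [[|[|b]] bi];
    by rewrite //= ?addKn.
rewrite (@det_block_schur _ 2 m) //.
set S := (X in \det X * _ * _ = _); rewrite det2 !det1.
have SE i j : S i j = s (ps2 i) (ws2 j).
  rewrite /s !mxE; congr (_ - _); apply: eq_bigr => l _; rewrite !mxE.
  by congr (_ * _); apply: eq_bigr => l' _; rewrite !mxE.
by rewrite !SE /ps2 /ws2 /=; ring.
Qed.

End KernelDet.

Section IzerginKorepin.
Variables (F : fieldType) (x y : F).
Implicit Types (p w : F) (ps ws : seq F).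
Local Notation Zin := (Zinhom x y).

Definition wt_ab p w := wt_a p w * wt_b x y p w.
Definition ik_mx n ps ws := kernel_mx 0 (fun p w => (wt_ab p w)^-1) n ps ws.
Definition prod_ab ps ws := \prod_(p <- ps) \prod_(w <- ws) wt_ab p w.

Lemma prod_ab_consl p ps ws :
  prod_ab (p :: ps) ws = \prod_(w <- ws) wt_ab p w * prod_ab ps ws.
Proof. by rewrite /prod_ab big_cons. Qed.

Lemma prod_ab_consr ps w ws :
  prod_ab ps (w :: ws) = \prod_(p <- ps) wt_ab p w * prod_ab ps ws.
Proof.
by rewrite /prod_ab -big_split; apply: eq_bigr => p _; rewrite big_cons.
Qed.

(** The orientation of the differences is a parameter because interpolation produces opposite ones
    for rows and columns. *)
Fixpoint vandermonde (f : F -> F -> F) s : F :=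
  if s is a :: s' then \prod_(b <- s') f a b * vandermonde f s' else 1.
Local Notation vdm := (vandermonde (fun a b => a - b)).
Local Notation vdm_op := (vandermonde (fun a b => b - a)).

(** The sign comes from moving the entry of index [j] to the front; it matches the cofactor sign in
    the determinant. *)
Lemma vandermonde_del ws j : (j < size ws)%N ->
  vdm ws = (-1) ^+ j * \prod_(u <- del j ws) (ws`_j - u) * vdm (del j ws).
Proof.
elim: ws j => [|w ws IH] [|j] //= js; first by rewrite /del /= drop0 mul1r.
rewrite (IH j js) (prod_del 0 _ js) -[del j.+1 _]/(w :: del j ws) /=.
by rewrite big_cons exprS; ring.
Qed.

(** Induction on the rows: after multiplication by the Vandermonde products, the interpolation sum
    for the first row is, term by term, the Laplace expansion along it. *)
Lemma izergin_korepin ps ws : interpolable x y ws -> size ws = size ps ->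
  {in ps & ws, forall p w, wt_ab p w != 0} ->
  Zin ps ws * vdm_op ps * vdm ws =
  prod_ab ps ws * \det (ik_mx (size ps) ps ws).
Proof.
elim: ps ws => [|p ps IH] ws iws ss nz.
  rewrite (size0nil ss) /prod_ab big_nil det_mx00 /Zinhom /= !mulr1.
  by rewrite /weights /=.
have intp := interpolation p iws ss.
transitivity ((Zin (p :: ps) ws * \prod_(q <- ps) (q - p)) *
              vdm_op ps * vdm ws); first by rewrite /=; ring.
rewrite intp (expand_det_row _ 0) mulr_sumr !mulr_suml /= ss.
apply: eq_bigr => j _.
have js : (j < size ws)%N by rewrite ss ltn_ord.
have [x0 uw w0 bnz] := iws.
have [ud wd] := andP (uniq_del 0 js uw).
have sub u : u \in del j ws -> u \in ws.
  by rewrite {2}(split_del 0 js) !mem_cat inE => /orP[]->; rewrite ?orbT.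
have sd : size (del j ws) = size ps by rewrite size_del // ss.
have {}IH : Zin ps (del j ws) * vdm_op ps * vdm (del j ws) =
    prod_ab ps (del j ws) * \det (ik_mx (size ps) ps (del j ws)).
  apply: IH => //.
    split=> //; first by apply: contra w0; apply: sub.
    by move=> u w /sub uw' /sub ww; apply: bnz.
  by move=> q w qp /sub ww; apply: nz => //; rewrite inE qp orbT.
have -> : cofactor (ik_mx (size ps).+1 (p :: ps) ws) 0 j =
    (-1) ^+ j * \det (ik_mx (size ps) ps (del j ws)).
  rewrite /cofactor add0n; congr (_ * \det _); apply/matrixP => a b.
  by rewrite !mxE nth_del // ltnW.
have -> : interp_term x y ps ws p j =
    \prod_(u <- del j ws) wt_ab p u / \prod_(u <- del j ws) (ws`_j - u) *
    \prod_(q <- ps) wt_ab q ws`_j * Zin ps (del j ws).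
  by rewrite /interp_term big_split /= prodfV.
rewrite (vandermonde_del js).
have splitP (f : F -> F) : \prod_(w <- ws) f w =
    f ws`_j * \prod_(u <- del j ws) f u := prod_del 0 f js.
have -> : prod_ab (p :: ps) ws = wt_ab p ws`_j *
    \prod_(u <- del j ws) wt_ab p u *
    (\prod_(q <- ps) wt_ab q ws`_j * prod_ab ps (del j ws)).
  rewrite /prod_ab big_cons splitP -big_split /=; congr (_ * _).
  by apply: eq_bigr => q _; exact: splitP.
rewrite mxE /=.
have nzp : wt_ab p ws`_j != 0 by apply: nz; rewrite ?mem_nth ?mem_head.
have nzd : \prod_(u <- del j ws) (ws`_j - u) != 0.
  rewrite prodf_seq_neq0; apply/allP => u ud' /=; rewrite subr_eq0.
  by apply: contraNneq wd => ->.
transitivity ((-1) ^+ j *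
  (\prod_(u <- del j ws) wt_ab p u * \prod_(q <- ps) wt_ab q ws`_j *
   (Zin ps (del j ws) * vdm_op ps * vdm (del j ws)))).
  by field; exact: nzd.
by rewrite IH; field; exact: nzp.
Qed.

Lemma interpolable_sub ws ws' : uniq ws' -> {subset ws' <= ws} ->
  interpolable x y ws -> interpolable x y ws'.
Proof.
move=> u' sub [x0 _ w0 bnz]; split=> //; first by apply: contra w0; apply: sub.
by move=> u w /sub uw /sub ww; apply: bnz.
Qed.

Lemma vandermonde_neq0 s : uniq s -> (vdm s != 0) && (vdm_op s != 0).
Proof.
elim: s => [|a s IH] /=; first by rewrite oner_eq0.
move=> /andP[as' /IH/andP[v1 v2]]; rewrite !mulf_neq0 //;
  rewrite prodf_seq_neq0; apply/allP => b bs /=; rewrite subr_eq0;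
  by apply: contraNneq as' => ba; rewrite ?ba // -ba.
Qed.

Lemma Zinhom_jacobi p p' ps w w' ws :
  interpolable x y [:: w, w' & ws] -> uniq [:: p, p' & ps] ->
  size ws = size ps ->
  {in [:: p, p' & ps] & [:: w, w' & ws], forall p w, wt_ab p w != 0} ->
  Zin ps ws != 0 ->
  Zin [:: p, p' & ps] [:: w, w' & ws] * Zin ps ws *
    ((p' - p) * (w - w')) =
  wt_ab p w' * wt_ab p' w * Zin (p :: ps) (w :: ws) *
    Zin (p' :: ps) (w' :: ws) -
  wt_ab p w * wt_ab p' w' * Zin (p :: ps) (w' :: ws) *
    Zin (p' :: ps) (w :: ws).
Proof.
move=> iws up ss nz Z0; have [_ uw _ _] := iws.
have sw : [/\ uniq (w :: ws), uniq (w' :: ws) & uniq ws].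
  by move: uw => /=; rewrite inE negb_or => /and3P[/andP[_ ->] -> ->].
have sp : [/\ uniq (p :: ps), uniq (p' :: ps) & uniq ps].
  by move: up => /=; rewrite inE negb_or => /and3P[/andP[_ ->] -> ->].
case: sw sp => uw1 uw2 uw3 [up1 up2 up3].
have IK qs vs : uniq vs -> {subset vs <= [:: w, w' & ws]} ->
  {subset qs <= [:: p, p' & ps]} -> size vs = size qs ->
  Zin qs vs * vdm_op qs * vdm vs =
  prod_ab qs vs * \det (ik_mx (size qs) qs vs).
  move=> uv sv sq sz; apply: izergin_korepin => //.
    exact: interpolable_sub iws.
  by move=> q v /sq qp /sv vw; apply: nz.
have subw1 : {subset w :: ws <= [:: w, w' & ws]}.
  by move=> u; rewrite !inE => /orP[]->; rewrite ?orbT.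
have subw2 : {subset w' :: ws <= [:: w, w' & ws]}.
  by move=> u; rewrite !inE => /orP[]->; rewrite ?orbT.
have subw3 : {subset ws <= [:: w, w' & ws]}.
  by move=> u; rewrite !inE => ->; rewrite ?orbT.
have subp1 : {subset p :: ps <= [:: p, p' & ps]}.
  by move=> u; rewrite !inE => /orP[]->; rewrite ?orbT.
have subp2 : {subset p' :: ps <= [:: p, p' & ps]}.
  by move=> u; rewrite !inE => /orP[]->; rewrite ?orbT.
have subp3 : {subset ps <= [:: p, p' & ps]}.
  by move=> u; rewrite !inE => ->; rewrite ?orbT.
have E := IK _ _ uw (fun _ => id) (fun _ => id) (congr1 (fun n => n.+2) ss).
have E0 := IK _ _ uw3 subw3 subp3 ss.
have E11 := IK _ _ uw1 subw1 subp1 (congr1 S ss).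
have E12 := IK _ _ uw2 subw2 subp1 (congr1 S ss).
have E21 := IK _ _ uw1 subw1 subp2 (congr1 S ss).
have E22 := IK _ _ uw2 subw2 subp2 (congr1 S ss).
have vp := vandermonde_neq0 up; have vw := vandermonde_neq0 uw.
have vp3 := vandermonde_neq0 up3; have vw3 := vandermonde_neq0 uw3.
(* The determinant formula is read backwards: a nonzero partition function makes the pivot block
   invertible. *)
have d0 : \det (ik_mx (size ps) ps ws) != 0.
  apply: contraNneq Z0 => d0; move/eqP: E0; rewrite d0 mulr0 !mulf_eq0.
  by case/andP: vp3 => _ /negPf->; case/andP: vw3 => /negPf-> _; rewrite !orbF.
have J := det_kernel_jacobi p p' w w' d0; rewrite -!/(ik_mx _ _ _) in J.
move: E E0 E11 E12 E21 E22 J vp vw vp3 vw3.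
rewrite !prod_ab_consl !prod_ab_consr /= !big_cons.
move: (\det (ik_mx (size ps).+2 _ _)) (\det (ik_mx (size ps) _ _)) => d d'.
move: (\det (ik_mx _ (p :: _) (w :: _))) (\det (ik_mx _ (p :: _) (w' :: _)))
  (\det (ik_mx _ (p' :: _) (w :: _))) (\det (ik_mx _ (p' :: _) (w' :: _))).
move=> d11 d12 d21 d22.
move: (Zin [:: p, p' & ps] _) (Zin ps _) (Zin (p :: ps) (w :: _))
 (Zin (p :: ps) (w' :: _)) (Zin (p' :: ps) (w :: _))
 (Zin (p' :: ps) (w' :: _)) => z z0 z11 z12 z21 z22.
move: (vdm ws) (vdm_op ps) => vw vp.
move: (\prod_(b <- ps) (b - p)) (\prod_(b <- ps) (b - p')) => vp1 vp2.
move: (\prod_(b <- ws) (w - b)) (\prod_(b <- ws) (w' - b)) => vw1 vw2.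
move: (wt_ab p w) (wt_ab p w') (wt_ab p' w) (wt_ab p' w') => a11 a12 a21 a22.
move: (\prod_(i <- ps) wt_ab i w) (\prod_(i <- ps) wt_ab i w') => b1 b2.
move: (prod_ab ps ws) => g.
move: (\prod_(i <- ws) wt_ab p i) (\prod_(i <- ws) wt_ab p' i) => c1 c2.
move: (p' - p) (w - w') => dp dw.
move=> E E0 E11 E12 E21 E22 J /andP[_ nvp] /andP[nvw _] _ _.
(* This is the Vandermonde part common to all three terms. What remains is [dp * dw] on the left
   and, on the right, the weights at the two crossings that each pair of smaller lattices misses. *)
have nK : vp1 * vp2 * vp ^+ 2 * (vw1 * vw2 * vw ^+ 2) != 0.
  move: nvp nvw; rewrite !mulf_eq0 !negb_or.
  by do 2![case/and3P=> /andP[_ ->] -> ->].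
apply: (mulfI nK).
transitivity ((z * (dp * vp1 * (vp2 * vp)) * (dw * vw1 * (vw2 * vw))) *
   (z0 * vp * vw)); first by ring.
rewrite E E0.
transitivity (a11 * a12 * a21 * a22 * c1 * c2 * b1 * b2 * g ^+ 2 * (d * d')).
  by ring.
rewrite J.
transitivity (a12 * a21 * (z11 * (vp1 * vp) * (vw1 * vw)) *
   (z22 * (vp2 * vp) * (vw2 * vw)) -
   a11 * a22 * (z12 * (vp1 * vp) * (vw2 * vw)) *
   (z21 * (vp2 * vp) * (vw1 * vw))); last by ring.
by rewrite E11 E12 E21 E22; ring.
Qed.

End IzerginKorepin.

(** * Removing the genericity assumptions *)

Section PolynomialFunctions.
Variable F : fieldType.
Hypothesis char0 : [pchar F] =i pred0.
Implicit Types (f g : F -> F) (Q : F -> Prop).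

Definition polyfun f := exists q : {poly F}, forall e, f e = q.[e].

Definition generic Q :=
  exists2 q : {poly F}, q != 0 & forall e, q.[e] != 0 -> Q e.

Lemma natr_inj : injective (fun n : nat => n%:R : F).
Proof.
have F0 := (pcharf0P F).1 char0.
move=> m n /eqP; wlog le_mn : m n / (m <= n)%N.
  by move=> wl; case: (leqP m n) => [/wl//|/ltnW/wl le_nm];
    rewrite eq_sym => /le_nm.
by rewrite eq_sym -subr_eq0 -natrB // F0 subn_eq0 => nm; apply/eqP;
  rewrite eqn_leq le_mn.
Qed.

Lemma poly_all_roots (q : {poly F}) : (forall e, q.[e] = 0) -> q = 0.
Proof.
move=> q0; apply/eqP; apply: contraT => /max_poly_roots qr.
have := qr [seq n%:R | n <- iota 0 (size q)].
rewrite map_inj_uniq ?iota_uniq; last exact: natr_inj.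
rewrite size_map size_iota ltnn; apply=> //.
by rewrite all_map; apply/allP => n _; rewrite /= rootE q0.
Qed.

Lemma polyfun_cst c : polyfun (fun=> c).
Proof. by exists c%:P => e; rewrite hornerC. Qed.

Lemma polyfun_aff a b : polyfun (fun e => a + b * e).
Proof. by exists (a%:P + b *: 'X) => e; rewrite !hornerE. Qed.

Lemma polyfunD f g : polyfun f -> polyfun g -> polyfun (fun e => f e + g e).
Proof. by case=> p fE [q gE]; exists (p + q) => e; rewrite fE gE hornerD. Qed.

Lemma polyfunM f g : polyfun f -> polyfun g -> polyfun (fun e => f e * g e).
Proof. by case=> p fE [q gE]; exists (p * q) => e; rewrite fE gE hornerM. Qed.

Lemma polyfunB f g : polyfun f -> polyfun g -> polyfun (fun e => f e - g e).
Proof.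
by case=> p fE [q gE]; exists (p - q) => e; rewrite fE gE hornerD hornerN.
Qed.

Lemma generic_and Q Q' :
  generic Q -> generic Q' -> generic (fun e => Q e /\ Q' e).
Proof.
case=> p p0 pQ [q q0 qQ]; exists (p * q); first by rewrite mulf_neq0.
by move=> e; rewrite hornerM mulf_eq0 negb_or => /andP[/pQ ? /qQ].
Qed.

Lemma generic_mono Q Q' : (forall e, Q e -> Q' e) -> generic Q -> generic Q'.
Proof. by move=> QQ' [q q0 qQ]; exists q => // e /qQ/QQ'. Qed.

Lemma generic_all (T : eqType) (r : seq T) (Q : T -> F -> bool) :
  {in r, forall t, generic (Q t)} -> generic (fun e => all (Q^~ e) r).
Proof.
elim: r => [|t r IH] Qr; first by exists 1; rewrite ?oner_eq0.
have: generic (fun e => Q t e /\ all (Q^~ e) r).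
  apply: generic_and; first by apply: Qr; rewrite mem_head.
  by apply: IH => u ur; apply: Qr; rewrite inE ur orbT.
by apply: generic_mono => e [/= -> ->].
Qed.

Lemma generic_neq0 f e0 : polyfun f -> f e0 != 0 -> generic (fun e => f e != 0).
Proof.
case=> q fE; rewrite fE => q0; exists q => [|e]; last by rewrite fE.
by apply: contraNneq q0 => ->; rewrite horner0.
Qed.

(** Wherever the polynomial of the generic condition does not vanish, [f] does; the product vanishes
    everywhere, hence is zero. *)
Lemma generic_eq0 f : polyfun f -> generic (fun e => f e = 0) ->
  forall e, f e = 0.
Proof.
case=> q fE [r r0 rf]; suff q0 : q = 0 by move=> e; rewrite fE q0 horner0.
apply/eqP; have /eqP : q * r = 0.
  apply: poly_all_roots => e; rewrite hornerM -fE.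
  by have [->|/rf->] := eqVneq r.[e] 0; rewrite ?mulr0 ?mul0r.
by rewrite mulf_eq0 (negPf r0) orbF.
Qed.

Definition aff e (c : F * F) := c.1 + c.2 * e.

(** Distinct slopes make any two parameters generically different even when they start equal;
    counted from a positive [k], the slopes are also nonzero. *)
Fixpoint tilt k (s : seq F) : seq (F * F) :=
  if s is a :: s' then (a, k%:R) :: tilt k.+1 s' else [::].

Lemma size_tilt k s : size (tilt k s) = size s.
Proof. by elim: s k => //= a s IH k; rewrite IH. Qed.

Lemma aff0_tilt k s : [seq aff 0 c | c <- tilt k s] = s.
Proof. by elim: s k => //= a s IH k; rewrite IH /aff mulr0 addr0. Qed.

Lemma tilt_slope k s c : c \in tilt k s ->
  exists2 j, (k <= j < k + size s)%N & c.2 = j%:R.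
Proof.
elim: s k => //= a s IH k; rewrite inE => /orP[/eqP->|/IH[j kj ->]].
  by exists k => //; lia.
by exists j => //; lia.
Qed.

Lemma generic_aff_neq (c d : F * F) : c.2 != d.2 ->
  generic (fun e => aff e c != aff e d).
Proof.
(* At the value of [e] supplied here the two lines differ by exactly 1. *)
move=> cd; have := @generic_neq0 (fun e => aff e c - aff e d)
  ((1 - (c.1 - d.1)) / (c.2 - d.2)).
move=> h; apply: (generic_mono (Q := fun e => aff e c - aff e d != 0)).
  by move=> e; rewrite subr_eq0.
apply: h; first by apply: polyfunB; exact: polyfun_aff.
suff -> : aff ((1 - (c.1 - d.1)) / (c.2 - d.2)) c -
  aff ((1 - (c.1 - d.1)) / (c.2 - d.2)) d = 1 by exact: oner_neq0.
by rewrite /aff; field; rewrite subr_eq0.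
Qed.

Lemma generic_uniq_tilt k s :
  generic (fun e => uniq [seq aff e c | c <- tilt k s]).
Proof.
elim: s k => [|a s IH] k /=; first by exists 1; rewrite ?oner_eq0.
have: generic (fun e =>
   all (fun c => aff e (a, k%:R) != aff e c) (tilt k.+1 s) /\
   uniq [seq aff e c | c <- tilt k.+1 s]).
  apply: generic_and => //; apply: generic_all => c /tilt_slope[j kj cj].
  apply: generic_aff_neq; rewrite /= cj; apply/eqP => /natr_inj; lia.
apply: generic_mono => e [/allP cn ->]; rewrite andbT.
by apply/mapP => -[c ct /eqP]; apply/negP/cn.
Qed.

End PolynomialFunctions.

(** * The bilinear relation for arbitrary parameters *)

Section Specialization.
Variables (F : fieldType) (x y : F).
Hypothesis char0 : [pchar F] =i pred0.
Local Notation Zin := (Zinhom x y).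
Local Notation wtab := (wt_ab x y).

Lemma polyfun_wt_a c d : polyfun (fun e : F => wt_a (aff e c) (aff e d)).
Proof. by apply: polyfunB; apply: polyfun_aff. Qed.

Lemma polyfun_wt_b c d : polyfun (fun e => wt_b x y (aff e c) (aff e d)).
Proof.
apply: polyfunD; first exact: polyfun_cst.
apply: polyfunM; first exact: polyfun_aff.
apply: polyfunB; last exact: polyfun_cst.
by apply: polyfunM; [apply: polyfun_cst | apply: polyfun_aff].
Qed.

Lemma polyfun_wt_ab c d : polyfun (fun e => wtab (aff e c) (aff e d)).
Proof.
by apply: polyfunM; [apply: polyfun_wt_a | apply: polyfun_wt_b].
Qed.

Lemma polyfun_wt_c c : polyfun (fun e => wt_c x y (aff e c)).
Proof.
apply: polyfunD; last exact: polyfun_cst.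
have pc := polyfun_aff c.1 c.2.
apply: polyfunB; apply: polyfunM => //; try exact: polyfun_cst.
exact: polyfunM.
Qed.

Lemma polyfun_weight c d v :
  polyfun (fun e => weight x y (aff e c) (aff e d) v).
Proof.
case: v => /=; try exact: polyfun_wt_a; try exact: polyfun_wt_b.
- by apply: polyfunM; [apply: polyfun_cst | apply: polyfun_wt_a].
- exact: polyfun_cst.
- by apply: polyfunM; apply: polyfun_wt_c.
Qed.

Lemma polyfun_row_op c ds h (G : F -> seq bool -> F) s :
  (forall t, polyfun (G^~ t)) ->
  polyfun (fun e => row_op
    [seq weight x y (aff e c) w | w <- [seq aff e d | d <- ds]] h (G e) s).
Proof.
elim: ds h G s => [|d ds IH] h G [|a s] Gp /=; try exact: polyfun_cst.
  by case: h => //; apply: polyfun_cst.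
have IHc k b : polyfun (fun e => row_op
    [seq weight x y (aff e c) w | w <- [seq aff e d | d <- ds]] k
    (G e \o cons b) s).
  by apply: (IH k (fun e => G e \o cons b)) => t; exact: (Gp (b :: t)).
have pw v := polyfun_weight c d v.
case: a; case: h.
- by apply: polyfunD; apply: polyfunM => //;
  [exact: (pw VA1) | exact: (pw VC2)].
- by apply: polyfunM => //; exact: (pw VB1).
- by apply: polyfunM => //; exact: (pw VB2).
- by apply: polyfunD; apply: polyfunM => //;
  [exact: (pw VA2) | exact: (pw VC1)].
Qed.

Lemma polyfun_Zinhom cs ds :
  polyfun (fun e => Zin [seq aff e c | c <- cs] [seq aff e d | d <- ds]).
Proof.
have: forall s, polyfun (fun e => state_sum
  (weights x y [seq aff e c | c <- cs] [seq aff e d | d <- ds]) s).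
  elim: cs => [|c cs IH] s /=; first exact: polyfun_cst.
  exact: polyfun_row_op.
case/(_ (nseq (size ds) false)) => q qE; exists q => e.
by rewrite -qE /Zinhom size_map.
Qed.

(** The coefficient of e^2 is [x * c.2 * d.2] whatever the base points are, so [c = d] is
    allowed. *)
Lemma generic_wt_b c d : x != 0 -> c.2 != 0 -> d.2 != 0 ->
  generic (fun e => wt_b x y (aff e c) (aff e d) != 0).
Proof.
move=> x0 c0 d0.
pose q : {poly F} := 1 + (d.1%:P + d.2 *: 'X) *
  (x%:P * (c.1%:P + c.2 *: 'X) - (x + 1 - y)%:P).
exists q => [|e]; last first.
  by rewrite /q !hornerE /wt_b /aff.
suff q2 : q`_2 = x * c.2 * d.2.
  by apply: contraTneq isT => q0; move/eqP: q2;
    rewrite q0 coef0 eq_sym !mulf_eq0 (negPf x0) (negPf c0) (negPf d0).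
have -> : q = (1 + d.1 * (x * c.1 - (x + 1 - y)))%:P +
  (d.1 * x * c.2 + d.2 * (x * c.1 - (x + 1 - y)))%:P * 'X +
  (x * c.2 * d.2)%:P * 'X^2.
  by rewrite /q -!mul_polyC !(rmorphD, rmorphM, rmorphN, rmorph1) /=; ring.
by rewrite !coefD !coefCM coefC coefX coefXn /= !mulr0 !add0r mulr1.
Qed.

(* Every spectral parameter is tilted along its own direction; the identity
   holds for generic values of the tilt, hence for all of them. *)
Lemma Zinhom_bilinear p p' ps w w' ws : x != 0 -> size ws = size ps ->
  Zin ps ws != 0 ->
  Zin [:: p, p' & ps] [:: w, w' & ws] * Zin ps ws *
    ((p' - p) * (w - w')) =
  wtab p w' * wtab p' w * Zin (p :: ps) (w :: ws) *
    Zin (p' :: ps) (w' :: ws) -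
  wtab p w * wtab p' w' * Zin (p :: ps) (w' :: ws) *
    Zin (p' :: ps) (w :: ws).
Proof.
(* The slopes are 1 and 2 for [p] and [p'], then 3 up to [k - 1] for [ps], [k] and [k + 1] for [w]
   and [w'], and [k + 2] onwards for [ws]: all distinct and nonzero. *)
move=> x0 ss Z0; pose k := (size ps).+3.
pose P e i c := aff e (c, i%:R : F).
pose cs := tilt 3 ps; pose ds := tilt k.+2 ws.
pose M e := [seq aff e c | c <- cs]; pose N e := [seq aff e d | d <- ds].
pose f e := Zin [:: aff e (p, 1%:R), aff e (p', 2%:R) & M e]
    [:: aff e (w, k%:R), aff e (w', k.+1%:R) & N e] * Zin (M e) (N e) *
    ((aff e (p', 2%:R) - aff e (p, 1%:R)) *
     (aff e (w, k%:R) - aff e (w', k.+1%:R))) -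
  (wtab (aff e (p, 1%:R)) (aff e (w', k.+1%:R)) *
   wtab (aff e (p', 2%:R)) (aff e (w, k%:R)) *
   Zin (aff e (p, 1%:R) :: M e) (aff e (w, k%:R) :: N e) *
   Zin (aff e (p', 2%:R) :: M e) (aff e (w', k.+1%:R) :: N e) -
  wtab (aff e (p, 1%:R)) (aff e (w, k%:R)) *
   wtab (aff e (p', 2%:R)) (aff e (w', k.+1%:R)) *
   Zin (aff e (p, 1%:R) :: M e) (aff e (w', k.+1%:R) :: N e) *
   Zin (aff e (p', 2%:R) :: M e) (aff e (w, k%:R) :: N e)).
suff /(_ 0)/eqP : forall e, f e = 0.
  rewrite /f /M /N !aff0_tilt /aff !mulr0 !addr0 subr_eq0 => /eqP.
  exact.
have pZ cs' ds' := polyfun_Zinhom cs' ds'.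
apply: generic_eq0 => //.
  apply: polyfunB; last apply: polyfunB.
  - apply: polyfunM; first apply: polyfunM.
    + exact: (pZ [:: (p, 1%:R), (p', 2%:R) & cs] [:: (w, _), (w', _) & ds]).
    + exact: pZ.
    + by apply: polyfunM; apply: polyfunB; apply: polyfun_aff.
  - apply: polyfunM; first apply: polyfunM; first apply: polyfunM;
      try exact: polyfun_wt_ab.
    + exact: (pZ ((p, _) :: cs) ((w, _) :: ds)).
    + exact: (pZ ((p', _) :: cs) ((w', _) :: ds)).
  - apply: polyfunM; first apply: polyfunM; first apply: polyfunM;
      try exact: polyfun_wt_ab.
    + exact: (pZ ((p, _) :: cs) ((w', _) :: ds)).
    + exact: (pZ ((p', _) :: cs) ((w, _) :: ds)).
pose cs2 := tilt 1 [:: p, p' & ps]; pose ds2 := tilt k [:: w, w' & ws].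
have sl0 l (s : seq F) c : c \in tilt l.+1 s -> c.2 != 0.
  by case/tilt_slope => [[|j]] // _ ->; rewrite ((pcharf0P F).1 char0).
have gab : generic (fun e => all (fun c => all (fun d =>
    wtab (aff e c) (aff e d) != 0) ds2) cs2).
  apply: (generic_all (Q := fun c e => all _ _)) => c cc.
  apply: (generic_all (Q := fun d e => _ != 0)) => d dd.
  have cd : c.2 != d.2.
    case: (tilt_slope cc) (tilt_slope dd) => i hi -> [j hj ->].
    by apply/eqP => /(natr_inj char0); move: hi hj => /=; lia.
  have := generic_and (generic_aff_neq cd)
    (generic_wt_b x0 (sl0 _ _ _ cc) (sl0 _ _ _ dd)).
  by apply: generic_mono => e [ha hb]; rewrite mulf_neq0 // subr_eq0.
have gbb : generic (fun e => all (fun c => all (fun d =>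
    wt_b x y (aff e c) (aff e d) != 0) ds2) ds2).
  apply: (generic_all (Q := fun c e => all _ _)) => c /sl0 cc.
  by apply: (generic_all (Q := fun d e => _ != 0)) => d /sl0;
    apply: generic_wt_b.
have g0 : generic (fun e => all (fun d => aff e d != 0) ds2).
  apply: (generic_all (Q := fun d e => _ != 0)) => d /sl0 dd.
  have := @generic_aff_neq _ d (0, 0) dd.
  by apply: generic_mono => e; rewrite /aff /= mul0r addr0.
have gZ : generic (fun e => Zin (M e) (N e) != 0).
  by apply: (@generic_neq0 _ _ 0); [apply: pZ | rewrite /M /N !aff0_tilt].
have gup := generic_uniq_tilt char0 1 [:: p, p' & ps].
have guw := generic_uniq_tilt char0 k [:: w, w' & ws].
have := generic_and (generic_and gab gbb) (generic_and (generic_and g0 gZ)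
  (generic_and gup guw)).
apply: generic_mono => e [[hab hbb] [[h0 hZ] [hup huw]]].
apply/eqP; rewrite subr_eq0; apply/eqP; apply: Zinhom_jacobi => //.
- split=> //.
    apply/negP => /(@mapP _ _ (aff e) ds2)[d /(allP h0)/[swap] <-].
    by rewrite eqxx.
  move=> u v /(@mapP _ _ (aff e) ds2)[c cc ->].
  by move=> /(@mapP _ _ (aff e) ds2)[d dd ->];
    exact: (allP (allP hbb _ cc) _ dd).
- by rewrite !size_map !size_tilt.
- move=> q v /(@mapP _ _ (aff e) cs2)[c cc ->].
  by move=> /(@mapP _ _ (aff e) ds2)[d dd ->];
    exact: (allP (allP hab _ cc) _ dd).
Qed.

End Specialization.

(** * Alternating sign matrices as six-vertex configurations *)

(** Partial sums of rows and columns are kept as booleans. [update] is addition of [e] exactly when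
    [compatible a e] holds, that is, when the sum stays in {0, 1}. *)
Definition update (a : bool) (e : int) : bool :=
  if e == 1 then true else if e == -1 then false else a.

Definition compatible (a : bool) (e : int) : bool :=
  if e == 1 then ~~ a else if e == -1 then a else true.

Fixpoint edge (a : bool) (r : nat -> int) j : bool :=
  if j is j'.+1 then update (edge a r j') (r j') else a.

Definition line_ok a n (r : nat -> int) : bool :=
  all (fun j => compatible (edge a r j) (r j)) (iota 0 n) && edge a r n.

Definition vertex_of (a h : bool) (e : int) : vertex :=
  if e == 1 then VC1 else if e == -1 then VC2 else
  if a then (if h then VA1 else VB1) else (if h then VB2 else VA2).

Definition kind (A : nat -> nat -> int) i j : vertex :=
  vertex_of (edge false (A^~ j) i) (edge false (A i) j) (A i j).

(** Entries are extended by 0 to all natural indices, so that edges can be defined by recursion. *)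
Definition ext n (f : 'I_n -> int) (j : nat) : int := oapp f 0 (insub j).

Definition ext2 m n (f : 'I_m -> 'I_n -> int) i j : int :=
  ext (fun k => ext (f k) j) i.

Definition entry n (M : 'M[asm_entry]_n) : nat -> nat -> int :=
  ext2 (fun i j => val (M i j)).

Lemma extE n (f : 'I_n -> int) (i : 'I_n) : ext f i = f i.
Proof. by rewrite /ext valK. Qed.

Lemma entryE n (M : 'M[asm_entry]_n) (i j : 'I_n) :
  entry M i j = int_mx M i j.
Proof. by rewrite /entry /ext2 !extE mxE. Qed.

Lemma edge_shift a r j : edge a r j.+1 = edge (update a (r 0%N)) (r \o S) j.
Proof. by elim: j => //= j ->. Qed.

Lemma eq_edge a r r' j : r =1 r' -> edge a r j = edge a r' j.
Proof. by move=> rr'; elim: j => //= j ->; rewrite rr'. Qed.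

Lemma eq_line_ok a n r r' : r =1 r' -> line_ok a n r = line_ok a n r'.
Proof.
move=> rr'; rewrite /line_ok (eq_edge _ _ rr'); congr (_ && _).
by apply: eq_all => j; rewrite (eq_edge _ _ rr') rr'.
Qed.

Lemma mkseq_recl (T : Type) (f : nat -> T) n :
  mkseq f n.+1 = f 0%N :: mkseq (f \o S) n.
Proof. by rewrite /mkseq /= (iotaDl 1 0) -map_comp. Qed.

Lemma all_iotaS (a : pred nat) n :
  all a (iota 0 n.+1) = a 0%N && all (a \o S) (iota 0 n).
Proof. by rewrite /= (iotaDl 1 0) all_map. Qed.

Definition alt_rel (a b : int) := a * b < 0.

Definition is_asm_entry (e : int) : bool := e \in [:: 0; 1; -1 : int].

Lemma asm_entry_cases (e : int) : is_asm_entry e -> [\/ e = 0, e = 1 | e = -1].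
Proof. by rewrite /is_asm_entry !inE => /or3P[]/eqP->; constructor. Qed.

(** The initial edge acts as an earlier nonzero entry: 1 if the partial sum is already 1, and -1
    otherwise. *)
Lemma line_ok_path h n (r : nat -> int) : (forall j, is_asm_entry (r j)) ->
  line_ok h n r =
  path alt_rel (if h then 1 else -1) [seq a <- mkseq r n | a != 0] &&
  (\sum_(j < n) r j == (~~ h)%:Z).
Proof.
elim: n h r => [|n IH] h r re.
  by rewrite /line_ok big_ord0; case: h.
rewrite mkseq_recl big_ord_recl /= /line_ok all_iotaS edge_shift /=.
have -> : all ((fun j => compatible (edge h r j) (r j)) \o S) (iota 0 n) =
  all (fun j => compatible (edge (update h (r 0%N)) (r \o S) j) ((r \o S) j))
      (iota 0 n).
  by apply: eq_all => j; rewrite -edge_shift.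
rewrite -andbA -/(line_ok (update h (r 0%N)) n (r \o S)) IH; last first.
  by move=> j; apply: re.
rewrite (eq_bigr (fun j : 'I_n => (r \o S) j)) //; set t := \sum_(_ < _) _.
by case: (asm_entry_cases (re 0%N)) => ->; case: h;
  rewrite /update /compatible /= ?add0r //=; congr (_ && _);
  apply/eqP/eqP; lia.
Qed.

Lemma path_alt_sum a (l : seq int) :
  all (fun e => (e == 1) || (e == -1)) (a :: l) -> path alt_rel a l ->
  \sum_(e <- l) e = 0 \/ \sum_(e <- l) e = - a.
Proof.
elim: l a => [|b l IH] a; first by rewrite big_nil; left.
rewrite big_cons /= => /and3P[a1 b1 l1] /andP[ab /(IH _ _) {}IH].
move: a1 b1 ab (IH); rewrite /alt_rel /= l1.
by case/orP=> /eqP->; case/orP=> /eqP-> // _; move=> /(_ isT) [] ->; lia.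
Qed.

(** Alternation alone does not fix the first nonzero entry. The total 1 does: after a leading -1 the
    rest sums to 0 or 1, so the total would be -1 or 0. *)
Lemma asm_line n (r : nat -> int) : (forall j, is_asm_entry (r j)) ->
  alternating (mkseq r n) && (\sum_(j < n) r j == 1) = line_ok false n r.
Proof.
move=> re; rewrite line_ok_path // /alternating -/alt_rel.
have sE : \sum_(j < n) r j = \sum_(e <- [seq a <- mkseq r n | a != 0]) e.
  have iE : iota 0 n = index_iota 0 n by rewrite /index_iota subn0.
  rewrite big_filter /mkseq big_map iE big_mkord.
  by rewrite [RHS]big_mkcond; apply: eq_bigr => i _; case: eqP.
rewrite sE; have: all (fun e => (e == 1) || (e == -1))
   [seq a <- mkseq r n | a != 0].
  apply/allP => e; rewrite mem_filter => /andP[e0 /mapP[j _ ej]].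
  by have := re j; rewrite -ej /is_asm_entry !inE (negPf e0).
case: [seq _ <- _ | _] => [|a l] //; rewrite [sorted _ _]/= [path _ _ _]/=.
move=> al; case pl: (path _ a l); rewrite /= pl ?andbF //= andbT.
have a1 : (a == 1) || (a == -1) by case/andP: al.
have := path_alt_sum al pl; rewrite big_cons.
by case/orP: a1 => /eqP-> [] ->.
Qed.

Lemma entry_asm n (M : 'M[asm_entry]_n) i j : is_asm_entry (entry M i j).
Proof.
rewrite /entry /ext2 /ext; case: (insub i) => [k|] //=.
by case: (insub j) => [l|] //=; exact: ssvalP.
Qed.

Lemma is_asmE n (M : 'M[asm_entry]_n) :
  is_asm (int_mx M) =
  all (fun i => line_ok false n (entry M i)) (iota 0 n) &&
  all (fun j => line_ok false n ((entry M)^~ j)) (iota 0 n).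
Proof.
have ent := entry_asm M.
have iotaP (P : pred nat) : all P (iota 0 n) = [forall i : 'I_n, P i].
  apply/allP/forallP => [h k|h k]; first by apply: h; rewrite mem_iota ltn_ord.
  by rewrite mem_iota => /andP[_ k_n]; apply: (h (Ordinal k_n)).
have rowE (A : 'M[int]_n) (k : 'I_n) (r : nat -> int) :
    (forall j : 'I_n, r j = A k j) -> (forall j, is_asm_entry (r j)) ->
    asm_row A k = line_ok false n r.
  move=> rA re; rewrite -asm_line // /asm_row; congr (alternating _ && _).
    rewrite /row_seq /mkseq -val_enum_ord -map_comp; apply: eq_map => j.
    by rewrite /= rA.
  by congr (_ == _); apply: eq_bigr => j _; rewrite rA.
rewrite /is_asm !iotaP; congr andb; apply: eq_forallb => i.
  by apply: rowE => j //; rewrite entryE.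
apply: rowE => j; first by rewrite mxE -entryE.
exact: ent.
Qed.

(** * State sums as sums over matrices *)

Section Expansion.
Variable F : comNzRingType.
Implicit Types (U : nat -> nat -> vertex -> F).

Lemma sum_asm_entry (f : int -> F) :
  \sum_(e : asm_entry) f (val e) = f 0 + f 1 + f (-1).
Proof.
rewrite -(big_map val predT f) (perm_big [:: 0; 1; -1 : int]).
  by rewrite !big_cons big_nil /= addr0 addrA.
rewrite uniq_perm ?map_inj_uniq ?index_enum_uniq //; first exact: val_inj.
move=> e; apply/mapP/idP => [[u _ ->]|ie]; first exact: valP.
by exists (SeqSub ie); rewrite ?mem_index_enum.
Qed.

Section FfunCons.
Variables (T : finType) (n : nat).

Definition ffun_cons (x : T * {ffun 'I_n -> T}) : {ffun 'I_n.+1 -> T} :=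
  [ffun i => oapp x.2 x.1 (unlift ord0 i)].

Lemma sum_ffunS (f : {ffun 'I_n.+1 -> T} -> F) :
  \sum_g f g = \sum_a \sum_g f (ffun_cons (a, g)).
Proof.
rewrite pair_big /= (reindex ffun_cons) /=; first by apply: eq_bigr => -[].
exists (fun g : {ffun 'I_n.+1 -> T} => (g ord0, [ffun i => g (lift ord0 i)])).
  move=> [a g] _ /=; congr pair; first by rewrite ffunE unlift_none.
  by apply/ffunP => i; rewrite !ffunE liftK.
move=> g _; apply/ffunP => i; rewrite ffunE.
by case: unliftP => [j ->|->] //=; rewrite ffunE.
Qed.

End FfunCons.

Lemma ext_ffun_cons n (T : finType) (v : T -> int) x (j : nat) :
  ext (fun i : 'I_n.+1 => v (ffun_cons x i)) j =
  if j is j'.+1 then ext (fun i : 'I_n => v (x.2 i)) j' else v x.1.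
Proof.
rewrite /ext; case: insubP => [i _ <-|] /=.
  rewrite ffunE; case: unliftP => [k ->|->] //=.
  by rewrite valK.
case: j => [|j] //; rewrite ltnS -leqNgt => nj.
by rewrite insubF // ltnNge nj.
Qed.

(** A choice of branches in [row_op] is a row of entries. Incompatible rows stay in the sum with
    coefficient 0, so the vertices assigned to them do not matter. *)
Lemma row_op_sum n (u : nat -> vertex -> F) h G (s : nat -> bool) :
  row_op (mkseq u n) h G (mkseq s n) =
  \sum_(r : {ffun 'I_n -> asm_entry}) let e := ext (fun i => val (r i)) in
    ((all (fun j => compatible (s j) (e j)) (iota 0 n)
      && line_ok h n e)%:R *
     \prod_(j < n) u j (vertex_of (s j) (edge h e j) (e j)))
    * G (mkseq (fun j => update (s j) (e j)) n).
Proof.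
elim: n u h G s => [|n IH] u h G s.
  rewrite (big_pred1 [ffun i : 'I_0 => SeqSub (mem_head 0 [:: 1; -1])]).
    rewrite /line_ok /= big_ord0 mulr1.
    by case: h; rewrite ?mul1r ?mul0r.
  by move=> r; apply/esym/eqP/ffunP => -[].
rewrite sum_ffunS !mkseq_recl.
pose t k e := row_op (mkseq (u \o S) n) k
  (G \o cons (update (s 0%N) e)) (mkseq (s \o S) n).
transitivity (\sum_(e : asm_entry)
  (compatible (s 0%N) (val e) && compatible h (val e))%:R *
   u 0%N (vertex_of (s 0%N) h (val e)) * t (update h (val e)) (val e)).
  rewrite (sum_asm_entry (fun e => (compatible (s 0%N) e && compatible h e)%:R *
   u 0%N (vertex_of (s 0%N) h e) * t (update h e) e)).
  by rewrite /t /=; case: (s 0%N); case: h;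
    rewrite /compatible /update /vertex_of /=
    ?mul0r ?mul1r ?addr0 ?add0r.
apply: eq_bigr => e _; rewrite /t IH mulr_sumr; apply: eq_bigr => r _;
  lazy zeta.
set e1 := ext _; set e2 := ext (fun i => val (ffun_cons _ i)).
have eE j : e2 j = if j is j'.+1 then e1 j' else val e.
  by rewrite /e2 (@ext_ffun_cons n _ val).
rewrite mkseq_recl !eE all_iotaS big_ord_recl !eE.
have edgeE j : edge h e2 j.+1 = edge (update h (val e)) e1 j.
  by rewrite edge_shift eE; apply: eq_edge => k; rewrite /= eE.
have -> : line_ok h n.+1 e2 = compatible h (val e) &&
    line_ok (update h (val e)) n e1.
  rewrite /line_ok all_iotaS edgeE eE -andbA; congr [&& _, _ & _].
  by apply: eq_all => j; rewrite /= -/(edge h e2 j.+1) edgeE eE.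
have -> : all ((fun j => compatible (s j) (e2 j)) \o S) (iota 0 n) =
    all (fun j => compatible (s j.+1) (e1 j)) (iota 0 n).
  by apply: eq_all => j; rewrite /= eE.
have -> : \prod_(i < n) u (lift ord0 i) (vertex_of (s (lift ord0 i))
      (edge h e2 (lift ord0 i)) (e2 (lift ord0 i))) =
    \prod_(j < n) u j.+1 (vertex_of (s j.+1)
      (edge (update h (val e)) e1 j) (e1 j)).
  by apply: eq_bigr => j _; rewrite lift0 edgeE eE.
have -> : mkseq ((fun j => update (s j) (e2 j)) \o S) n =
    mkseq (fun j => update (s j.+1) (e1 j)) n.
  by apply: eq_map => j; rewrite /= eE.
rewrite /=; case: (compatible (s 0%N) _); case: (compatible h _);
  rewrite ?andbF ?mul0r //=; ring.
Qed.

Lemma ext2_ffun_cons m n (T : finType) (v : T -> int)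
    (x : {ffun 'I_n -> T} * {ffun 'I_m -> {ffun 'I_n -> T}}) i j :
  ext2 (fun (k : 'I_m.+1) (l : 'I_n) => v (ffun_cons x k l)) i j =
  if i is i'.+1 then ext2 (fun (k : 'I_m) (l : 'I_n) => v (x.2 k l)) i' j
  else ext (fun l => v (x.1 l)) j.
Proof.
exact: (@ext_ffun_cons m {ffun 'I_n -> T} (fun g => ext (fun l => v (g l)) j)).
Qed.

(** The top edges [s] are arbitrary because the induction continues below the first row with updated
    edges; functions of functions let that row split off. *)
Lemma state_sum_sum m n U (s : nat -> bool) :
  state_sum (mkseq (fun i => mkseq (U i) n) m) (mkseq s n) =
  \sum_(M : {ffun 'I_m -> {ffun 'I_n -> asm_entry}})
    let A := ext2 (fun i j => val (M i j)) in
    (all (fun i => line_ok false n (A i)) (iota 0 m) &&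
     all (fun j => line_ok (s j) m (A^~ j)) (iota 0 n))%:R *
    \prod_(i < m) \prod_(j < n)
      U i j (vertex_of (edge (s j) (A^~ j) i) (edge false (A i) j) (A i j)).
Proof.
elim: m U s => [|m IH] U s.
  rewrite (big_pred1 [ffun i : 'I_0 =>
    [ffun i => SeqSub (mem_head 0 [:: 1; -1])]]).
    by rewrite /= big_ord0 mulr1 all_map.
  by move=> r; apply/esym/eqP/ffunP => -[].
rewrite sum_ffunS mkseq_recl [LHS]/= row_op_sum; apply: eq_bigr => r _.
lazy zeta; rewrite IH mulr_sumr; apply: eq_bigr => M _; lazy zeta.
set A1 := ext2 _.
set A2 := ext2 (fun (i : 'I_m.+1) (j : 'I_n) => val (ffun_cons (r, M) i j)).
set r1 := ext _.
have AE i j : A2 i j = if i is i'.+1 then A1 i' j else r1 j.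
  by rewrite /A2 (@ext2_ffun_cons m n _ val).
have edgeE j i : edge (s j) (A2^~ j) i.+1 =
    edge (update (s j) (r1 j)) (A1^~ j) i.
  by rewrite edge_shift AE; apply: eq_edge => k; rewrite /= AE.
rewrite all_iotaS big_ord_recl.
have A20 : A2 0%N =1 r1 by move=> j; rewrite AE.
have A2S i : A2 i.+1 =1 A1 i by move=> j; rewrite AE.
rewrite (eq_line_ok _ _ A20).
have -> : all ((fun i => line_ok false n (A2 i)) \o S) (iota 0 m) =
    all (fun i => line_ok false n (A1 i)) (iota 0 m).
  by apply: eq_all => i; apply: eq_line_ok.
have -> : all (fun j => line_ok (s j) m.+1 (A2^~ j)) (iota 0 n) =
   all (fun j => compatible (s j) (r1 j)) (iota 0 n) &&
   all (fun j => line_ok (update (s j) (r1 j)) m (A1^~ j)) (iota 0 n).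
  rewrite -all_predI; apply: eq_all => j.
  rewrite /line_ok all_iotaS edgeE A20 /= -andbA; congr [&& _, _ & _].
  by apply: eq_all => i; rewrite /= -/(edge (s j) (A2^~ j) i.+1) edgeE AE.
have -> : \prod_(j < n) U (@ord0 m) j (vertex_of (edge (s j) (A2^~ j) (@ord0 m))
     (edge false (A2 (@ord0 m)) j) (A2 (@ord0 m) j)) =
   \prod_(j < n) U 0%N j (vertex_of (s j) (edge false r1 j) (r1 j)).
  by apply: eq_bigr => j _; rewrite A20 (eq_edge _ _ A20).
have -> : \prod_(i < m) \prod_(j < n) U (lift ord0 i) j
    (vertex_of (edge (s j) (A2^~ j) (lift ord0 i))
       (edge false (A2 (lift ord0 i)) j) (A2 (lift ord0 i) j)) =
   \prod_(i < m) \prod_(j < n) U i.+1 j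
    (vertex_of (edge (update (s j) (r1 j)) (A1^~ j) i)
       (edge false (A1 i) j) (A1 i j)).
  apply: eq_bigr => i _; apply: eq_bigr => j _; rewrite lift0 edgeE AE.
  by rewrite (eq_edge _ _ (A2S i)).
case: (all (fun j => compatible _ _) _); case: (line_ok false n r1);
  rewrite ?andbF ?mul0r //=; rewrite mulrCA -!mulrA //.
by rewrite mul1r.
Qed.

Definition asm_sum n U : F :=
  \sum_(M in ASM n) \prod_(i < n) \prod_(j < n) U i j (kind (entry M) i j).

Lemma asm_sumE n U :
  asm_sum n U = state_sum (mkseq (fun i => mkseq (U i) n) n) (nseq n false).
Proof.
have -> : nseq n false = mkseq (fun=> false) n.
  by elim: (n) => // k IH; rewrite mkseq_recl -IH.
rewrite state_sum_sum /asm_sum big_mkcond.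
pose h (M : 'M[asm_entry]_n) := [ffun i => [ffun j => M i j]].
rewrite [RHS](reindex h) /=; last first.
  exists (fun f : {ffun 'I_n -> {ffun 'I_n -> asm_entry}} =>
     \matrix_(i, j) f i j) => M _.
    by apply/matrixP => i j; rewrite mxE !ffunE.
  by apply/ffunP => i; apply/ffunP => j; rewrite !ffunE mxE.
apply: eq_bigr => M _; rewrite inE is_asmE.
set A := ext2 _.
have AE i j : A i j = entry M i j.
  rewrite /A /entry /ext2 /ext; case: (insub i) => [k|] //=.
  by case: (insub j) => [l|] //=; rewrite !ffunE.
have -> : all (fun i => line_ok false n (A i)) (iota 0 n) =
    all (fun i => line_ok false n (entry M i)) (iota 0 n).
  by apply: eq_all => i; apply: eq_line_ok.
have -> : all (fun j => line_ok false n (A^~ j)) (iota 0 n) =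
    all (fun j => line_ok false n ((entry M)^~ j)) (iota 0 n).
  by apply: eq_all => j; apply: eq_line_ok.
case: (_ && _); rewrite ?mul1r ?mul0r //.
apply: eq_bigr => i _; apply: eq_bigr => j _; rewrite /kind AE.
by congr (U i j (vertex_of _ _ _)); apply: eq_edge => k; rewrite AE.
Qed.

End Expansion.

(** * Boundary statistics and symmetries *)

Section Lines.
Variables (n : nat) (r : nat -> int).
Hypothesis r_asm : forall j, is_asm_entry (r j).
Hypothesis r_ok : line_ok false n r.

Lemma line_compat j : (j < n)%N -> compatible (edge false r j) (r j).
Proof.
by case/andP: r_ok => /allP h _ jn; apply: h; rewrite mem_iota.
Qed.

Lemma line_end : edge false r n.
Proof. by case/andP: r_ok. Qed.

Lemma line_edge_sum j : (j <= n)%N -> (edge false r j)%:Z = \sum_(k < j) r k.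
Proof.
elim: j => [|j IH] jn; first by rewrite big_ord0.
rewrite big_ord_recr /= -IH ?(ltnW jn) //; have := line_compat jn.
by case: (asm_entry_cases (r_asm j)) => ->; case: (edge _ _ _).
Qed.

Lemma line_sum : \sum_(j < n) r j = 1.
Proof. by rewrite -line_edge_sum // line_end. Qed.

Lemma edge_true_one j : edge false r j -> exists2 k, (k < j)%N & r k = 1.
Proof.
elim: j => [|j IH] //=; rewrite /update; case: eqP => [rj _|_].
  by exists j.
by case: eqP => // _ /IH[k kj rk]; exists k => //; apply: ltnW.
Qed.

Lemma edge_false_one j : (j <= n)%N -> ~~ edge false r j ->
  exists2 k, (j <= k < n)%N & r k = 1.
Proof.
have := line_end; elim: (n) => [|m IH] /= em jm ej.
  by move: em ej; rewrite (_ : j = 0%N) //; lia.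
have [jm1|jm1] := eqVneq j m.+1; first by move: em ej; rewrite jm1 /= => ->.
move: em; rewrite /update; case: eqP => [rm _|_]; first by exists m => //; lia.
case: eqP => // _ /IH[] //; first by lia.
by move=> k km rk; exists k => //; lia.
Qed.

Section Nonneg.
Hypothesis r_nneg : forall j, (j < n)%N -> r j != -1.

Lemma edge_mono j k : (j <= k <= n)%N -> edge false r j -> edge false r k.
Proof.
elim: k => [|k IH]; first by case: j.
move=> jk ej; have [<-//|jk1] := eqVneq j k.+1.
rewrite /= /update (negPf (r_nneg _)); last by lia.
by case: ifP => // _; apply: IH => //; lia.
Qed.

Lemma one_after j : (j < n)%N -> r j = 0 ->
  (exists2 k, (k < n)%N & (r k == 1) && (j < k)%N) <-> ~~ edge false r j.
Proof.
move=> jn rj; split=> [[k kn /andP[/eqP rk jk]]|/(edge_false_one (ltnW jn))].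
  apply/negP => ej; have := line_compat kn.
  by rewrite rk (edge_mono _ ej) //; lia.
case=> k /andP[jk kn] rk; exists k => //; rewrite rk eqxx ltn_neqAle jk andbT.
by apply: contra_eq_neq rk => <-; rewrite rj.
Qed.

Lemma one_before j : (j < n)%N ->
  (exists2 k, (k < n)%N & (r k == 1) && (k < j)%N) <-> edge false r j.
Proof.
move=> jn; split=> [[k kn /andP[/eqP rk kj]]|/edge_true_one[k kj rk]].
  by apply: (@edge_mono k.+1); [lia | rewrite /= /update rk].
by exists k; [lia | rewrite rk eqxx].
Qed.

Lemma count_not_one : (\sum_(j < n) (r j != 1%R))%N = n.-1.
Proof.
have : (\sum_(j < n) (r j != 1%R))%N%:Z + 1 = n%:Z; last by lia.
rewrite -natz natr_sum -[X in _ + X = _]line_sum -big_split /=.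
rewrite -[n in RHS]card_ord -natz.
rewrite -sumr_const; apply: eq_bigr => j _; have := r_nneg (ltn_ord j).
by case: (asm_entry_cases (r_asm j)) => -> //.
Qed.

End Nonneg.
End Lines.

Section AsmFacts.
Variables (n : nat) (M : 'M[asm_entry]_n).
Hypothesis M_asm : M \in ASM n.
Local Notation A := (entry M).

Lemma asm_row_ok i : (i < n)%N -> line_ok false n (A i).
Proof.
move: M_asm; rewrite inE is_asmE => /andP[/allP h _] i_n.
by apply: h; rewrite mem_iota.
Qed.

Lemma asm_col_ok j : (j < n)%N -> line_ok false n (A^~ j).
Proof.
move: M_asm; rewrite inE is_asmE => /andP[_ /allP h] j_n.
by apply: h; rewrite mem_iota.
Qed.

Lemma row_compat i j : (i < n)%N -> (j < n)%N ->
  compatible (edge false (A i) j) (A i j).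
Proof. by move=> i_n; apply: line_compat; apply: asm_row_ok. Qed.

Lemma col_compat i j : (i < n)%N -> (j < n)%N ->
  compatible (edge false (A^~ j) i) (A i j).
Proof. by move=> i_n j_n; apply: (line_compat (asm_col_ok j_n)). Qed.

Lemma top_nneg j : (j < n)%N -> A 0%N j != -1.
Proof.
move=> j_n; have n0 : (0 < n)%N by lia.
by apply/eqP => Aj; have := col_compat n0 j_n; rewrite Aj.
Qed.

Lemma left_nneg i : (i < n)%N -> A i 0%N != -1.
Proof.
move=> i_n; have n0 : (0 < n)%N by lia.
by apply/eqP => Ai; have := row_compat i_n n0; rewrite Ai.
Qed.

Lemma right_nneg i : (i < n)%N -> A i n.-1 != -1.
Proof.
move=> i_n; apply/eqP => Ai; have: edge false (A i) n.-1.+1.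
  by rewrite (prednK (leq_ltn_trans (leq0n i) i_n)) (line_end (asm_row_ok i_n)).
by rewrite /= Ai.
Qed.

End AsmFacts.

Definition is_A1 v := if v is VA1 then true else false.
Definition is_A2 v := if v is VA2 then true else false.
Definition is_C2 v := if v is VC2 then true else false.
Definition top_edge v := match v with VA1 | VB1 | VC2 => true | _ => false end.
(** In the top row V = 0 and in the left column H = 0; this and the next definition list the types
    an entry 0 can have there. *)
Definition is_AB_top v := match v with VA2 | VB2 => true | _ => false end.
Definition is_AB_left v := match v with VA2 | VB1 => true | _ => false end.

Section Statistics.
Variables (n : nat) (M : 'M[asm_entry]_n).
Hypothesis M_asm : M \in ASM n.
Local Notation A := (entry M).
Local Notation asm := (int_mx M).

(** Grouped by the row of the lower factor and the column of the upper one, each term is V times the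
    row sum up to and including the entry. This is 1 only at A1: V = 0 at an entry 1, and the row
    sum is 0 after an entry -1. *)
Lemma nuE : nu asm = (\sum_(i < n) \sum_(j < n) is_A1 (kind A i j))%N.
Proof.
transitivity (\sum_(i' < n) \sum_(j < n)
   (\sum_(i < n | (i < i')%N) asm i j) *
   (\sum_(j' < n | (j' <= j)%N) asm i' j')).
  rewrite /nu; under eq_bigr do rewrite big_mkcond.
  rewrite exchange_big; apply: eq_bigr => i' _ /=; rewrite -big_mkcond.
  rewrite exchange_big; apply: eq_bigr => j _ /=; rewrite mulr_suml.
  by apply: eq_bigr => i _; rewrite mulr_sumr.
rewrite -natz natr_sum; apply: eq_bigr => i _; rewrite natr_sum.
apply: eq_bigr => j _.
have -> : \sum_(k < n | (k < i)%N) asm k j = (edge false (A^~ j) i)%:Z.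
  have in_ : (i <= n)%N by exact: ltnW.
  have rA : forall k, is_asm_entry (A k j) by move=> k; apply: entry_asm.
  rewrite (@line_edge_sum n (A^~ j) rA (asm_col_ok M_asm (ltn_ord j)) i in_).
  rewrite (big_ord_widen n (fun k => A k j) in_).
  by apply: eq_bigr => k _; rewrite entryE.
have -> : \sum_(k < n | (k <= j)%N) asm i k = (edge false (A i) j.+1)%:Z.
  rewrite (@line_edge_sum n (A i) (entry_asm M i) (asm_row_ok M_asm (ltn_ord i))
    j.+1 (ltn_ord j)).
  rewrite (big_ord_widen n (fun k => A i k) (ltn_ord j)).
  by apply: eq_bigr => k _; rewrite entryE.
have := col_compat M_asm (ltn_ord i) (ltn_ord j).
have := row_compat M_asm (ltn_ord i) (ltn_ord j).
rewrite /kind /= /update /compatible /vertex_of.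
case: (asm_entry_cases (entry_asm M i j)) => ->;
  by case: (edge _ (A^~ _) _); case: (edge _ (A _) _).
Qed.

Lemma sum_card (P : 'I_n -> 'I_n -> bool) :
  #|[set p : 'I_n * 'I_n | P p.1 p.2]| = (\sum_(i < n) \sum_(j < n) P i j)%N.
Proof.
rewrite pair_big /= -sum1_card big_mkcond /=; apply: eq_bigr => -[i j] _.
by rewrite inE /=; case: (P i j).
Qed.

Lemma muE : mu asm = (\sum_(i < n) \sum_(j < n) is_C2 (kind A i j))%N.
Proof.
rewrite /mu (sum_card (fun i j => asm i j == -1)).
apply: eq_bigr => i _; apply: eq_bigr => j _; rewrite -entryE /kind /vertex_of.
case: (asm_entry_cases (entry_asm M i j)) => -> //=.
by do 2!case: (edge _ _ _).
Qed.

Lemma card_sum_row (P : 'I_n -> bool) :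
  #|[set j | P j]| = (\sum_(j < n) P j)%N.
Proof.
rewrite -sum1_card big_mkcond /=; apply: eq_bigr => j _.
by rewrite inE; case: (P j).
Qed.

Lemma rhoTE : rhoT asm =
  (\sum_(i < n) \sum_(j < n) ((i == 0 :> nat)%N && is_A2 (kind A i j)))%N.
Proof.
rewrite /rhoT card_sum_row exchange_big; apply: eq_bigr => j _ /=.
have n0 : (0 < n)%N := leq_ltn_trans (leq0n j) (ltn_ord j).
rewrite (bigD1 (Ordinal n0)) //= big1 ?addn0; last first.
  by move=> i; rewrite -val_eqE /= => /negPf->.
congr nat_of_bool; apply/existsP/idP.
  case=> i /existsP[k /and4P[/eqP i0 Aij Aik jk]].
  have iE : i = Ordinal n0 by apply: val_inj.
  move: Aij Aik; rewrite -!entryE iE /= => /eqP Aj /eqP Ak.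
  have /(one_after (asm_row_ok M_asm n0) (top_nneg M_asm) (ltn_ord j) Aj) :
    exists2 k, (k < n)%N & (A 0%N k == 1) && (j < k)%N.
    by exists (k : nat) => //; rewrite Ak jk eqxx.
  by rewrite /kind /vertex_of Aj /=; case: (edge _ _ _).
rewrite /kind /vertex_of /= => k2.
have Aj : A 0%N j = 0.
  by move: k2; case: (asm_entry_cases (entry_asm M 0 j)) => ->.
have /(one_after (asm_row_ok M_asm n0) (top_nneg M_asm) (ltn_ord j) Aj) :
  ~~ edge false (A 0%N) j by move: k2; rewrite Aj /=; case: (edge _ _ _).
case=> k kn /andP[Ak jk]; exists (Ordinal n0); apply/existsP.
by exists (Ordinal kn); rewrite -!entryE /= Aj Ak jk.
Qed.

Lemma rhoLE : rhoL asm =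
  (\sum_(i < n) \sum_(j < n) ((j == 0 :> nat)%N && is_A2 (kind A i j)))%N.
Proof.
rewrite /rhoL card_sum_row; apply: eq_bigr => i _ /=.
have n0 : (0 < n)%N := leq_ltn_trans (leq0n i) (ltn_ord i).
rewrite (bigD1 (Ordinal n0)) //= big1 ?addn0; last first.
  by move=> j; rewrite -val_eqE /= => /negPf->.
congr nat_of_bool; apply/existsP/idP.
  case=> j /existsP[k /and4P[/eqP j0 Aij Akj ik]].
  have jE : j = Ordinal n0 by apply: val_inj.
  move: Aij Akj; rewrite -!entryE jE /= => /eqP Ai /eqP Ak.
  have /(one_after (asm_col_ok M_asm n0) (left_nneg M_asm) (ltn_ord i) Ai) :
    exists2 k, (k < n)%N & (A k 0%N == 1) && (i < k)%N.
    by exists (k : nat) => //; rewrite Ak ik eqxx.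
  by rewrite /kind /vertex_of Ai /=; case: (edge _ _ _).
rewrite /kind /vertex_of /= => k2.
have Ai : A i 0%N = 0.
  by move: k2; case: (asm_entry_cases (entry_asm M i 0)) => ->.
have /(one_after (asm_col_ok M_asm n0) (left_nneg M_asm) (ltn_ord i) Ai) :
  ~~ edge false (A^~ 0%N) i by move: k2; rewrite Ai /=; case: (edge _ _ _).
case=> k kn /andP[Ak ik]; exists (Ordinal n0); apply/existsP.
by exists (Ordinal kn); rewrite -!entryE /= Ai Ak ik.
Qed.

(** An entry 0 in the last column has H = 1, because the right edge is 1; below the 1 it also has V
    = 1. *)
Lemma rhoRE : rhoR asm =
  (\sum_(i < n) \sum_(j < n) ((j.+1 == n)%N && is_A1 (kind A i j)))%N.
Proof.
rewrite /rhoR card_sum_row; apply: eq_bigr => i _ /=.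
have n0 : (n.-1 < n)%N by case: (n) i => [[]|].
rewrite (bigD1 (Ordinal n0)) //= big1 ?addn0; last first.
  move=> j; rewrite -val_eqE /= => jn; case: eqP => // jn'.
  by move/eqP: jn => []; lia.
have -> : (n.-1.+1 == n)%N by rewrite prednK ?eqxx //; lia.
have /= rowend : edge false (A i) n.-1.+1.
  by rewrite (ltn_predK n0) (line_end (asm_row_ok M_asm (ltn_ord i))).
congr nat_of_bool; apply/existsP/idP.
  case=> j /existsP[k /and4P[/eqP j0 Aij Akj ki]].
  have jE : j = Ordinal n0 by apply: val_inj => /=; lia.
  move: Aij Akj; rewrite -!entryE jE /= => /eqP Ai /eqP Ak.
  have /(one_before (asm_col_ok M_asm n0) (right_nneg M_asm) (ltn_ord i)) :
    exists2 k, (k < n)%N & (A k n.-1 == 1) && (k < i)%N.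
    by exists (k : nat) => //; rewrite Ak ki eqxx.
  by move: rowend; rewrite /update /kind /vertex_of Ai /= => -> ->.
rewrite /kind /vertex_of /= => k2.
have Ai : A i n.-1 = 0.
  by move: k2; case: (asm_entry_cases (entry_asm M i n.-1)) => ->.
have /(one_before (asm_col_ok M_asm n0) (right_nneg M_asm) (ltn_ord i)) :
  edge false (A^~ n.-1) i.
  by move: k2; rewrite Ai /=; case: (edge _ _ _) => //; case: (edge _ _ _).
case=> k kn /andP[Ak ki]; exists (Ordinal n0); apply/existsP.
exists (Ordinal kn); rewrite -!entryE /= Ai Ak ki /= andbT.
by rewrite prednK ?eqxx //; lia.
Qed.

(** Above row [i] exactly [i] vertical edges are 1, since each of the [i] earlier rows sums to 1. *)
Lemma top_edge_count :
  (\sum_(i < n) \sum_(j < n) top_edge (kind A i j))%N = (\sum_(i < n) i)%N.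
Proof.
apply: eq_bigr => i _; apply/eqP; rewrite -eqz_nat -natz natr_sum; apply/eqP.
transitivity (\sum_(j < n) \sum_(k < i) A k j).
  apply: eq_bigr => j _.
  have in_ : (i <= n)%N by exact: ltnW.
  have rA : forall k, is_asm_entry (A k j) by move=> k; apply: entry_asm.
  rewrite -(@line_edge_sum n (A^~ j) rA (asm_col_ok M_asm (ltn_ord j)) i in_).
  have := col_compat M_asm (ltn_ord i) (ltn_ord j).
  rewrite /kind /compatible /vertex_of.
  by case: (asm_entry_cases (entry_asm M i j)) => ->; case: (edge _ (A^~ _) _);
    case: (edge _ (A _) _).
rewrite exchange_big -[RHS]natz; transitivity (\sum_(k < i) (1 : int)).
  apply: eq_bigr => k _; apply: line_sum; first exact: entry_asm.
  by apply: asm_row_ok => //; apply: ltn_trans (ltn_ord k) (ltn_ord i).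
by rewrite sumr_const card_ord.
Qed.

Lemma top_count : (\sum_(i < n) \sum_(j < n)
  ((i == 0 :> nat)%N && is_AB_top (kind A i j)))%N = n.-1.
Proof.
case: (posnP n) => [n0|n0].
  by rewrite big1 => [|i _]; [rewrite n0 | have := ltn_ord i; lia].
rewrite (bigD1 (Ordinal n0)) //= [X in (_ + X)%N]big1 ?addn0; last first.
  move=> i; rewrite -val_eqE /= => /negPf->; exact: big1.
rewrite -(count_not_one (entry_asm M 0) (asm_row_ok M_asm n0) (top_nneg M_asm)).
apply: eq_bigr => j _; congr nat_of_bool; have := top_nneg M_asm (ltn_ord j).
rewrite /kind /vertex_of /=.
by case: (asm_entry_cases (entry_asm M 0 j)) => ->; case: (edge _ _ _).
Qed.

Lemma left_count : (\sum_(i < n) \sum_(j < n)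
  ((j == 0 :> nat)%N && is_AB_left (kind A i j)))%N = n.-1.
Proof.
case: (posnP n) => [n0|n0].
  by rewrite big1 => [|i _]; [rewrite n0 | have := ltn_ord i; lia].
rewrite exchange_big (bigD1 (Ordinal n0)) //= [X in (_ + X)%N]big1 ?addn0;
  last first.
  move=> j; rewrite -val_eqE /= => /negPf->; exact: big1.
rewrite -(count_not_one (fun i => entry_asm M i 0) (asm_col_ok M_asm n0)
  (left_nneg M_asm)).
apply: eq_bigr => i _; congr nat_of_bool; have := left_nneg M_asm (ltn_ord i).
rewrite /kind /vertex_of /=.
by case: (asm_entry_cases (entry_asm M i 0)) => ->; case: (edge _ _ _).
Qed.

End Statistics.

(** * Transposition and left-right reflection *)

Definition vertex_tr v := match v with VB1 => VB2 | VB2 => VB1 | _ => v end.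

(** At an entry 0, reflection keeps V and complements H. *)
Definition vertex_flip v :=
  match v with
  | VA1 => VB1 | VB1 => VA1 | VA2 => VB2 | VB2 => VA2 | _ => v
  end.

Definition flip_cols n (M : 'M[asm_entry]_n) : 'M[asm_entry]_n :=
  \matrix_(i, j) M i (rev_ord j).

Lemma entry_tr n (M : 'M[asm_entry]_n) i j : entry M^T i j = entry M j i.
Proof.
rewrite /entry /ext2 /ext; case: (insub i) => [k|]; case: (insub j) => [l|] //=.
by rewrite mxE.
Qed.

Lemma entry_flip n (M : 'M[asm_entry]_n) i j : (j < n)%N ->
  entry (flip_cols M) i j = entry M i (n - j.+1).
Proof.
move=> jn; rewrite /entry /ext2 /ext; case: (insub i) => [k|] //=.
rewrite (insubT (fun j => j < n)%N jn) /= mxE.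
have nj : (n - j.+1 < n)%N := rev_ord_proof (Ordinal jn).
rewrite (insubT (fun j => j < n)%N nj) /=.
by congr (val (M k _)); apply: val_inj.
Qed.

Lemma asm_tr n (M : 'M[asm_entry]_n) : (M^T \in ASM n) = (M \in ASM n).
Proof.
rewrite !inE !is_asmE andbC; congr andb; apply: eq_all => i;
  by apply: eq_line_ok => j; rewrite entry_tr.
Qed.

Lemma line_ok_flip n (r r' : nat -> int) :
  (forall j, is_asm_entry (r j)) -> (forall j, is_asm_entry (r' j)) ->
  (forall j, (j < n)%N -> r' j = r (n - j.+1)%N) ->
  line_ok false n r' = line_ok false n r.
Proof.
move=> ra ra' rE; rewrite -!asm_line //.
have -> : mkseq r' n = rev (mkseq r n).
  apply: (@eq_from_nth _ 0); rewrite ?size_rev !size_mkseq // => j jn.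
  have nj : (n - j.+1 < n)%N := rev_ord_proof (Ordinal jn).
  by rewrite nth_rev ?size_mkseq // !nth_mkseq // rE.
congr andb; last first.
  rewrite (reindex_inj rev_ord_inj) /=; congr (_ == _).
  apply: eq_bigr => j _; have := ltn_ord j => jn.
  by rewrite rE ?rev_ord_proof //=; congr r; lia.
rewrite /alternating filter_rev rev_sorted; apply: eq_sorted => a b.
by rewrite mulrC.
Qed.

Lemma asm_flip n (M : 'M[asm_entry]_n) :
  (flip_cols M \in ASM n) = (M \in ASM n).
Proof.
rewrite !inE !is_asmE; congr andb.
  apply: eq_in_all => i _; apply: line_ok_flip => [||j jn].
  - exact: entry_asm.
  - exact: entry_asm.
  - by rewrite entry_flip.
apply/allP/allP => h j; rewrite mem_iota => /andP[_ jn];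
  have nj : (n - j.+1 < n)%N := rev_ord_proof (Ordinal jn);
  have := h (n - j.+1)%N; rewrite mem_iota nj => /(_ isT); apply: etrans;
  apply: eq_line_ok => i; rewrite entry_flip //.
by congr entry; move: jn; rewrite /=; lia.
Qed.

Lemma kind_tr n (M : 'M[asm_entry]_n) i j :
  kind (entry M^T) i j = vertex_tr (kind (entry M) j i).
Proof.
rewrite /kind entry_tr (@eq_edge _ _ (entry M j)); last first.
  by move=> k; rewrite entry_tr.
rewrite [edge _ (entry M^T i) j](@eq_edge _ _ ((entry M)^~ i)); last first.
  by move=> k; rewrite entry_tr.
rewrite /vertex_of; case: ifP => // _; case: ifP => // _.
by do 2!case: (edge _ _ _).
Qed.

Lemma kind_flip n (M : 'M[asm_entry]_n) i j : M \in ASM n ->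
  (i < n)%N -> (j < n)%N ->
  kind (entry (flip_cols M)) i j =
  vertex_flip (kind (entry M) i (n - j.+1)).
Proof.
move=> Ma i_n j_n; rewrite /kind entry_flip //.
rewrite (@eq_edge _ _ ((entry M)^~ (n - j.+1)%N)); last first.
  by move=> k; rewrite entry_flip.
set e := entry M i (n - j.+1).
suff: e = 0 -> edge false (entry (flip_cols M) i) j =
   ~~ edge false (entry M i) (n - j.+1).
  have := entry_asm M i (n - j.+1); rewrite -/e /vertex_of.
  case/asm_entry_cases=> -> // /(_ erefl) ->.
  by case: (edge _ _ _); case: (edge _ _ _).
move=> e0; have Fa : flip_cols M \in ASM n by rewrite asm_flip.
have sF := line_edge_sum (entry_asm _ i) (asm_row_ok Fa i_n) (ltnW j_n).
have sM := line_edge_sum (entry_asm M i) (asm_row_ok Ma i_n) (leq_subr j.+1 n).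
have := line_sum (entry_asm M i) (asm_row_ok Ma i_n).
have nE : n = ((n - j.+1).+1 + j)%N by lia.
(* Around an entry 0 the sums from the left and from the right add up to 1, so exactly one of the
   two edges is 1. *)
have tot : \sum_(k < n) entry M i k =
  \sum_(k < (n - j.+1).+1) entry M i k + \sum_(k < j) entry (flip_cols M) i k.
  rewrite -(big_mkord predT (entry M i)) {1}nE.
  rewrite big_mkord big_split_ord; congr (_ + _).
  rewrite [RHS](reindex_inj rev_ord_inj) /=; apply: eq_bigr => k _.
  by have := ltn_ord k => kj; rewrite entry_flip; [congr entry; lia | lia].
rewrite tot big_ord_recr /= -/e e0 addr0 -sF -sM.
by case: (edge _ _ _); case: (edge _ _ _).
Qed.

Section AsmSums.
Variable F : fieldType.
Implicit Types (U : nat -> nat -> vertex -> F) (x y z : F).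

Lemma asm_sum_tr n U :
  asm_sum n U = asm_sum n (fun i j v => U j i (vertex_tr v)).
Proof.
rewrite /asm_sum (reindex_inj trmx_inj) /=.
apply: eq_big => [M|M _]; first exact: asm_tr.
rewrite exchange_big /=; apply: eq_bigr => i _; apply: eq_bigr => j _.
by rewrite kind_tr.
Qed.

Lemma flip_cols_inj n : injective (@flip_cols n).
Proof.
apply: (can_inj (g := @flip_cols n)) => M; apply/matrixP => i j.
by rewrite !mxE rev_ordK.
Qed.

Lemma asm_sum_flip n U :
  asm_sum n U = asm_sum n (fun i j v => U i (n - j.+1)%N (vertex_flip v)).
Proof.
rewrite /asm_sum (reindex_inj (@flip_cols_inj n)) /=.
apply: eq_big => [M|M]; first exact: asm_flip.
rewrite asm_flip => Ma; apply: eq_bigr => i _.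
rewrite [RHS](reindex_inj rev_ord_inj) /=; apply: eq_bigr => j _.
by rewrite kind_flip // subnSK // subKn // ltnW.
Qed.

(** Vertices with V = 1 in the top row or H = 1 in the left column do not occur, so the weights may
    disagree on them. *)
Lemma eq_asm_sum n U U' :
  (forall i j v, (i < n)%N -> (j < n)%N ->
    (i == 0%N) ==> ~~ top_edge v ->
    (j == 0%N) ==> (if v is (VA1 | VB2 | VC2) then false else true) ->
    U i j v = U' i j v) -> asm_sum n U = asm_sum n U'.
Proof.
move=> UU'; apply: eq_bigr => M Ma; apply: eq_bigr => i _;
  apply: eq_bigr => j _.
apply: UU' => //; apply/implyP => /eqP.
  move=> i0; have := top_nneg Ma (ltn_ord j); rewrite /kind /vertex_of i0 /=.
  by case: (asm_entry_cases (entry_asm M 0 j)) => ->; case: (edge _ _ _).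
move=> j0; have := left_nneg Ma (ltn_ord i); rewrite /kind /vertex_of j0 /=.
by case: (asm_entry_cases (entry_asm M i 0)) => ->; case: (edge _ _ _).
Qed.

Definition boundary_weight x y z1 z2 i j v : F :=
  x ^+ is_A1 v * y ^+ is_C2 v * z1 ^+ ((i == 0%N) && is_A2 v) *
  z2 ^+ ((j == 0%N) && is_A2 v).

Definition boundary_weight_tilde n x y z1 z2 i j v : F :=
  x ^+ is_A1 v * y ^+ is_C2 v * z1 ^+ ((i == 0%N) && is_A2 v) *
  z2 ^+ ((j.+1 == n) && is_A1 v).

Lemma prod2_exp n (c : F) (f : 'I_n -> 'I_n -> nat) :
  \prod_i \prod_j c ^+ f i j = c ^+ (\sum_i \sum_j f i j)%N.
Proof. by under eq_bigr do rewrite prodrXr; rewrite prodrXr. Qed.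

Lemma prod2_split n (f g : 'I_n -> 'I_n -> F) :
  \prod_i \prod_j (f i j * g i j) =
  \prod_i \prod_j f i j * \prod_i \prod_j g i j.
Proof. by under eq_bigr do rewrite big_split; rewrite big_split. Qed.

Lemma ZadjE n x y z1 z2 :
  Zadj n x y z1 z2 = asm_sum n (boundary_weight x y z1 z2).
Proof.
apply: eq_bigr => M Ma; lazy zeta; rewrite !prod2_split !prod2_exp.
by rewrite nuE // muE // rhoTE // rhoLE.
Qed.

Lemma Zadj_tildeE n x y z1 z2 :
  Zadj_tilde n x y z1 z2 = asm_sum n (boundary_weight_tilde n x y z1 z2).
Proof.
apply: eq_bigr => M Ma; lazy zeta; rewrite !prod2_split !prod2_exp.
by rewrite nuE // muE // rhoTE // rhoRE.
Qed.

Lemma Zref_adj n x y z : Zref n x y z = Zadj n x y z 1.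
Proof. by apply: eq_bigr => M _; rewrite /= expr1n mulr1. Qed.

Lemma Z_adj n x y : Z n x y = Zadj n x y 1 1.
Proof. by apply: eq_bigr => M _; rewrite /= !expr1n !mulr1. Qed.

Lemma Zref_tilde n x y z : Zref n x y z = Zadj_tilde n x y z 1.
Proof. by apply: eq_bigr => M _; rewrite /= expr1n mulr1. Qed.

Lemma Z_tilde n x y : Z n x y = Zadj_tilde n x y 1 1.
Proof. by apply: eq_bigr => M _; rewrite /= !expr1n !mulr1. Qed.

Lemma Zadj_tr n x y z1 z2 : Zadj n x y z1 z2 = Zadj n x y z2 z1.
Proof.
rewrite ZadjE asm_sum_tr ZadjE; apply: eq_asm_sum => i j v _ _ _ _.
by rewrite /boundary_weight; case: v => /=; rewrite ?andbF ?andbT; ring.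
Qed.

Lemma asm_sum_scale n U U' c (m : nat) (f : nat -> nat -> vertex -> nat) :
  (forall M, M \in ASM n ->
    (\sum_(i < n) \sum_(j < n) f i j (kind (entry M) i j))%N = m) ->
  (forall i j v, (i < n)%N -> (j < n)%N ->
    U i j v = c ^+ f i j v * U' i j v) ->
  asm_sum n U = c ^+ m * asm_sum n U'.
Proof.
move=> fm UU'; rewrite /asm_sum mulr_sumr; apply: eq_bigr => M Ma.
rewrite -(fm M Ma) -prod2_exp -prod2_split.
by apply: eq_bigr => i _; apply: eq_bigr => j _; rewrite UU'.
Qed.

(** Reflection turns the weight [x] of A1 into a weight of B1. As A1, B1 and C2 together occur n(n -
    1)/2 times, a fixed power of [x] times [x^-1] per A1 and [y / x] per C2 gives the same product.
    Likewise the n - 1 entries 0 of the top row are A2 or B2 and those of the left column A2 or B1,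
    which inverts [z1] and [z2]. *)
Lemma Zadj_tilde_flip n x y z1 z2 : x != 0 -> z1 != 0 -> z2 != 0 ->
  Zadj_tilde n x y z1 z2 =
  x ^+ (\sum_(i < n) i)%N * (z1 * z2) ^+ n.-1 *
  Zadj n x^-1 (y / x) z1^-1 z2^-1.
Proof.
move=> x0 z10 z20; rewrite Zadj_tildeE asm_sum_flip.
rewrite exprMn ZadjE -!mulrA.
rewrite (@asm_sum_scale n _ (fun i j v => z1 ^+ ((i == 0%N) && is_AB_top v) *
  (z2 ^+ ((j == 0%N) && is_AB_left v) *
     boundary_weight x^-1 (y / x) z1^-1 z2^-1 i j v)) x _
  (fun _ _ => top_edge) (@top_edge_count n)).
  rewrite (@asm_sum_scale n _ (fun i j v =>
     z2 ^+ ((j == 0%N) && is_AB_left v) *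
     boundary_weight x^-1 (y / x) z1^-1 z2^-1 i j v) z1 _
    (fun i _ v => (i == 0%N) && is_AB_top v) (@top_count n)) //.
  by rewrite (@asm_sum_scale n _ (boundary_weight x^-1 (y / x) z1^-1 z2^-1) z2 _
    (fun _ j v => (j == 0%N) && is_AB_left v) (@left_count n)).
move=> i j v _ jn; rewrite /boundary_weight_tilde /boundary_weight.
have -> : ((n - j.+1).+1 == n) = (j == 0%N) by apply/eqP/eqP; lia.
by case: (i == 0%N); case: (j == 0%N); case: v => /=; field;
  rewrite ?x0 ?z10 ?z20.
Qed.

End AsmSums.

(** * The recursion and its solution *)

Section Recursion.
Variables (F : fieldType) (x y : F).
Local Notation Zin := (Zinhom x y).

(* [c] is the weight of a corner vertex of type A2. *)
Definition deformed_weight c p a b i j v : F :=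
  match v with
  | VA1 => x
  | VA2 => if i == 0%N then if j == 0%N then c else p
           else if j == 0%N then a else 1
  | VB1 => if j == 0%N then b else 1
  | VB2 | VC1 => 1
  | VC2 => y
  end.

Lemma Z_bulk n c :
  Z n x y = asm_sum n (fun i j => deformed_weight c 1 1 1 i.+1 j.+1).
Proof.
rewrite Z_adj ZadjE; apply: eq_asm_sum => i j v _ _ _ _.
by rewrite /boundary_weight !expr1n !mulr1; case: v; rewrite /= ?mulr1 ?mul1r.
Qed.

(** [X] collects the configurations with A2 in the corner and does not depend on [c]. A C1 in the
    corner freezes the first row and column and leaves a bulk lattice of order [n]. *)
Lemma deformed_corner n p a b : exists X, forall c,
  asm_sum n.+1 (deformed_weight c p a b) = c * X + b ^+ n * Z n x y.
Proof.
pose U := deformed_weight 1 p a b.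
pose rows := mkseq (fun i => (U i.+1 0%N, mkseq (U i.+1 \o S) n)) n.
exists (row_op (mkseq (U 0%N \o S) n) false
  (state_sum [seq r.1 :: r.2 | r <- rows] \o cons false) (nseq n false)) => c.
pose V := deformed_weight c p a b.
have VE : mkseq (fun i => mkseq (V i) n.+1) n.+1 =
    (V 0%N 0%N :: mkseq (U 0%N \o S) n) :: [seq r.1 :: r.2 | r <- rows].
  rewrite mkseq_recl; congr (_ :: _); first exact: mkseq_recl.
  rewrite /rows /mkseq -map_comp; apply: eq_map => i /=.
  by rewrite -(mkseq_recl (U i.+1)).
have := state_sum_corner (V 0%N 0%N) (mkseq (U 0%N \o S) n) rows.
rewrite -VE size_mkseq asm_sumE => ->; congr (_ + _).
rewrite !mul1r /= (Z_bulk n 1) asm_sumE !big_map.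
rewrite big1 // mul1r big_const_seq count_predT size_iota iter_mulr_1 /rows.
congr (_ * state_sum _ _); rewrite /mkseq -map_comp; apply: eq_map => i /=.
by apply: eq_map => j.
Qed.

Lemma Zinhom_asm_sum n (pf wf : nat -> F) :
  Zin (mkseq pf n) (mkseq wf n) =
  asm_sum n (fun i j => weight x y (pf i) (wf j)).
Proof.
rewrite asm_sumE /Zinhom size_mkseq /weights /mkseq -map_comp.
by congr state_sum; apply: eq_map => i /=; rewrite -map_comp.
Qed.

Lemma mkseq_first n (a b : F) :
  mkseq (fun i => if i == 0%N then a else b) n.+1 = a :: nseq n b.
Proof.
rewrite mkseq_recl; congr (_ :: _); elim: (n) => // m IH.
by rewrite mkseq_recl; exact: (congr1 (cons b) IH).
Qed.

(** C2 never occurs in the first row or column, so its weight is [wt_c 1 * wt_c 0 = y] wherever it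
    does occur. *)
Lemma Zinhom_deformed n p w :
  Zin (p :: nseq n 1) (w :: nseq n 0) =
  asm_sum n.+1 (deformed_weight (p - w) p (1 - w) (1 + w * (y - 1))).
Proof.
rewrite -!mkseq_first Zinhom_asm_sum; apply: eq_asm_sum => i j v _ _.
case: i => [|i]; case: j => [|j]; case: v => //= _ _;
  rewrite /wt_a /wt_b /wt_c; ring.
Qed.

(** The left column has n - 1 vertices of type A2 or B1, each contributing one factor [b]. *)
Lemma Zadj_deformed n z1 z2 b :
  asm_sum n (deformed_weight (z1 * z2 * b) z1 (z2 * b) b) =
  b ^+ n.-1 * Zadj n x y z1 z2.
Proof.
rewrite ZadjE (@asm_sum_scale _ n _ (boundary_weight x y z1 z2) b n.-1
  (fun _ j v => (j == 0%N) && is_AB_left v) (@left_count n)) // => i j v _ _.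
rewrite /boundary_weight.
by case: i => [|i]; case: j => [|j]; case: v => //=; ring.
Qed.

Hypothesis char0 : [pchar F] =i pred0.

(* The row parameter is p = z1; the column parameter w is chosen so that the
   ratio of the weights a and b in the left column is z2. *)
Lemma Zadj_recursion m z1 z2 : x != 0 -> y != 0 -> z1 != 0 -> z2 != 0 ->
  1 + z2 * (y - 1) != 0 -> z1 * (1 + z2 * (y - 1)) != 1 - z2 ->
  Z m x y != 0 ->
  (z1 - 1) * (z2 - 1) * Z m x y * (Zadj m.+2 x y z1 z2 - Z m.+1 x y) =
  z1 * z2 * (y * Z m.+1 x y * Zadj m.+1 x y z1 z2 +
    (x * (z1 - 1) * (z2 - 1) - y) * Zref m.+1 x y z1 * Zref m.+1 x y z2).
Proof.
move=> x0 y0 z10 z20 d0 zd Zm0.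
pose d := 1 + z2 * (y - 1); pose w := (1 - z2) / d; pose b := y / d.
have bE : 1 + w * (y - 1) = b by rewrite /w /b /d; field.
have wE : 1 - w = z2 * b by rewrite /w /b /d; field.
have b0 : b != 0 by rewrite mulf_neq0 ?invr_eq0.
have zw : z1 - w != 0.
  rewrite subr_eq0; apply: contra zd => /eqP ->; apply/eqP.
  by rewrite /w -/d; field.
have nseqE (k : nat) (c : F) : c :: nseq k c = nseq k.+1 c by [].
have ZbulkE k : Zin (nseq k 1) (nseq k 0) = Z k x y.
  case: k => [|k]; first by rewrite Defs.Z0 /Zinhom.
  rewrite -!nseqE Zinhom_deformed subr0 mul0r addr0.
  have := Zadj_deformed k.+1 1 1 1; rewrite !mulr1 expr1n mul1r -Z_adj => <-.
  by [].
have ZrefE k : Zin (z1 :: nseq k 1) (nseq k.+1 0) = Zref k.+1 x y z1.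
  rewrite -nseqE Zinhom_deformed !subr0 mul0r addr0 Zref_adj.
  have := Zadj_deformed k.+1 z1 1 1; rewrite !mulr1 expr1n mul1r => <-.
  by [].
have ZrefE' k : Zin (nseq k.+1 1) (w :: nseq k 0) = b ^+ k * Zref k.+1 x y z2.
  rewrite -nseqE Zinhom_deformed bE wE Zref_adj Zadj_tr.
  by have := Zadj_deformed k.+1 1 z2 b; rewrite mul1r /= => <-.
have ZadjE' k : exists X,
    Zin (z1 :: nseq k 1) (w :: nseq k 0) = (z1 - w) * X + b ^+ k * Z k x y /\
    b ^+ k * Zadj k.+1 x y z1 z2 = z1 * z2 * b * X + b ^+ k * Z k x y.
  have [X XE] := deformed_corner k z1 (z2 * b) b; exists X; split.
    by rewrite Zinhom_deformed wE bE XE.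
  by have := Zadj_deformed k.+1 z1 z2 b; rewrite XE /= => <-.
have [X1 [E1 A1]] := ZadjE' m; have [X2 [E2 A2]] := ZadjE' m.+1.
(* The second row and column get the bulk values 1 and 0, so only the first ones stay deformed. *)
have J := @Zinhom_bilinear F x y char0 z1 1 (nseq m 1) w 0 (nseq m 0) x0.
rewrite !size_nseq ZbulkE in J; have {J} := J erefl Zm0.
rewrite !nseqE E1 E2 !ZbulkE ZrefE ZrefE' => J.
have nK : (z1 - w) * (b ^+ m * b) != 0.
  by apply: mulf_neq0 => //; apply: mulf_neq0 => //; apply: expf_neq0.
apply: (mulfI nK).
move: A1 A2 J; rewrite exprS /wt_ab /wt_a /wt_b.
move: (b ^+ m) (Z m x y) (Z m.+1 x y) (Zadj m.+1 _ _ _ _) (Zadj m.+2 _ _ _ _)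
  (Zref _ _ _ z1) (Zref _ _ _ z2) => g Y0 Y1 W1 W2 R1 R2.
move=> /eqP A1 /eqP A2 /eqP J.
move: A1 A2 J; rewrite -subr_eq0 => /eqP; set a1 := (X in X = 0) => A1.
rewrite -subr_eq0 => /eqP; set a2 := (X in X = 0) => A2.
rewrite -subr_eq0 => /eqP; set e := (X in X = 0) => J.
apply/eqP; rewrite -subr_eq0; apply/eqP.
(* The coefficients of [a1] and [a2] are those that eliminate the corner coefficients [X1] and [X2]
   from [e]. *)
transitivity (d * z1 * z2 * b * e -
  d * z1 * z2 * (z1 - w) * b ^+ 2 * Y1 * a1 +
  d * (z1 - w) * (1 - z1) * w * Y0 * a2); last by rewrite A1 A2 J; ring.
by rewrite /a1 /a2 /e /b /w /d; field.
Qed.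

End Recursion.

(** * Closed formulas *)

Lemma split_index n i : (1 <= i < n.+1)%N ->
  exists k r, [/\ i = k.+1, n = (k + r).+1 & (n.+1 - i)%N = r.+1].
Proof. by move=> i_n; exists i.-1, (n - i)%N; split; lia. Qed.

Section Formulas.
Variables (F : fieldType) (x y z1 z2 : F).
Hypothesis char0 : [pchar F] =i pred0.
Hypotheses (x0 : x != 0) (y0 : y != 0) (z10 : z1 != 0) (z20 : z2 != 0).
Hypotheses (z11 : z1 != 1) (z21 : z2 != 1) (Zn0 : forall n, Z n x y != 0).

Lemma Zadj1 (a b c d : F) : Zadj 1 a b c d = 1.
Proof. by rewrite ZadjE asm_sumE /= /boundary_weight /=; ring. Qed.

(** With u_n = Zadj_(n+1) / Z_n, the recursion reads u_(n+1) - 1 = t (u_n - 1 + c_(n+1)), starting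
    from u_0 = 1, with [t] and [c] as in the proof. *)
Lemma Zadj_formula n :
  1 + z2 * (y - 1) != 0 -> z1 * (1 + z2 * (y - 1)) != 1 - z2 ->
  Zadj n.+1 x y z1 z2 =
    Z n x y *
    (1 + \sum_(1 <= i < n.+1)
       (y * z1 * z2 / ((z1 - 1) * (z2 - 1))) ^+ (n.+1 - i) *
       (1 + (x * (z1 - 1) * (z2 - 1) - y) * Zref i x y z1 * Zref i x y z2 /
            (y * Z i.-1 x y * Z i x y))).
Proof.
move=> nz1 nz2; elim: n => [|n IH].
  by rewrite big_nil Zadj1 Defs.Z0 addr0 mulr1.
rewrite big_nat_recr //= subSnn expr1.
pose t := y * z1 * z2 / ((z1 - 1) * (z2 - 1)).
pose c i := 1 + (x * (z1 - 1) * (z2 - 1) - y) * Zref i x y z1 * Zref i x y z2 /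
  (y * Z i.-1 x y * Z i x y).
rewrite -/t -/(c n.+1).
have -> : \sum_(1 <= i < n.+1) t ^+ (n.+2 - i) * c i =
    t * \sum_(1 <= i < n.+1) t ^+ (n.+1 - i) * c i.
  rewrite mulr_sumr; apply: eq_big_nat => i /andP[_ i_n].
  by rewrite subSn ?(ltnW i_n) // exprS mulrA.
pose s := \sum_(1 <= i < n.+1) t ^+ (n.+1 - i) * c i.
rewrite -/s; have {}IH : Zadj n.+1 x y z1 z2 = Z n x y * (1 + s) := IH.
have z1n : z1 - 1 != 0 by rewrite subr_eq0.
have z2n : z2 - 1 != 0 by rewrite subr_eq0.
have R := Zadj_recursion char0 x0 y0 z10 z20 nz1 nz2 (Zn0 n).
have nK : (z1 - 1) * (z2 - 1) * Z n x y != 0 by rewrite !mulf_neq0.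
apply: (mulfI nK); move: R; rewrite mulrBr IH => /(canRL (subrK _)) ->.
rewrite /c /t /=.
by field; rewrite z1n z2n y0 !Zn0.
Qed.

End Formulas.

Section Tilde.
Variables (F : fieldType) (x y z1 z2 : F).
Hypothesis char0 : [pchar F] =i pred0.
Hypotheses (x0 : x != 0) (y0 : y != 0) (z10 : z1 != 0) (z20 : z2 != 0).
Hypotheses (z11 : z1 != 1) (z21 : z2 != 1) (Zn0 : forall n, Z n x y != 0).

Lemma Z_inv n : Z n x y = x ^+ (\sum_(i < n) i)%N * Z n x^-1 (y / x).
Proof.
rewrite Z_tilde Zadj_tilde_flip ?oner_eq0 // Z_adj !invr1.
by rewrite mulr1 expr1n mulr1.
Qed.

Lemma Zref_inv n z : z != 0 ->
  Zref n x y z = x ^+ (\sum_(i < n) i)%N * z ^+ n.-1 * Zref n x^-1 (y / x) z^-1.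
Proof.
move=> z0; rewrite Zref_tilde Zadj_tilde_flip ?oner_eq0 //.
by rewrite Zref_adj invr1 mulr1.
Qed.

(** The reflected formula is compared term by term. The powers of [x] from the two [Zref i], divided
    by those from [Z i.-1] and [Z i], leave [x ^+ i.-1]. The two inequations are those of
    [Zadj_formula] at the inverted arguments, cleared of denominators. *)
Lemma Zadj_tilde_formula n :
  x * z2 + y - x != 0 -> x * z2 + y - x != x * z1 * (z2 - 1) ->
  Zadj_tilde n.+1 x y z1 z2 =
    Z n x y *
    ((x * z1 * z2) ^+ n +
     \sum_(1 <= i < n.+1)
       (y / ((z1 - 1) * (z2 - 1))) ^+ (n.+1 - i) *
       (x ^+ i.-1 * (z1 * z2) ^+ n +
        (z1 * z2) ^+ (n.+1 - i - 1) * ((z1 - 1) * (z2 - 1) - y * z1 * z2) *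
          Zref i x y z1 * Zref i x y z2 /
          (y * Z i.-1 x y * Z i x y))).
Proof.
move=> nz1 nz2; rewrite Zadj_tilde_flip //=.
have xi0 : x^-1 != 0 by rewrite invr_eq0.
have z1i : z1^-1 != 1 by rewrite invr_eq1.
have z2i : z2^-1 != 1 by rewrite invr_eq1.
have Zi0 k : Z k x^-1 (y / x) != 0.
  by apply: contraNneq (Zn0 k) => Zk; rewrite Z_inv Zk mulr0.
have z1n : z1 - 1 != 0 by rewrite subr_eq0.
have z2n : z2 - 1 != 0 by rewrite subr_eq0.
have dE : 1 + z2^-1 * (y / x - 1) = (x * z2 + y - x) / (x * z2).
  by field; rewrite x0 z20.
rewrite Zadj_formula ?invr_eq0 ?mulf_neq0 //; first last.
- rewrite dE; apply: contra nz2 => /eqP E; apply/eqP.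
  have -> : x * z2 + y - x =
    x * z1 * z2 * (z1^-1 * ((x * z2 + y - x) / (x * z2))).
    by field; rewrite x0 z10 z20.
  by rewrite E; field.
- by rewrite dE !mulf_neq0 // invr_eq0 mulf_neq0.
rewrite big_ord_recr /= exprD.
set s := \sum_(1 <= i < n.+1) _; set s' := \sum_(1 <= i < n.+1) _.
suff -> : s' = (x * z1 * z2) ^+ n * s.
  by rewrite (Z_inv n) !exprMn; ring.
rewrite mulr_sumr; apply: eq_big_nat => i /split_index[k [r [iE nE E1]]].
have E2 : (n.+1 - i - 1)%N = r by rewrite E1 subn1.
rewrite E2 E1 nE iE /= {E1 E2 s s'}.
have Zk := Zi0 k; have Zk1 := Zi0 k.+1.
rewrite !Zref_inv // !(Z_inv k) !(Z_inv k.+1) big_ord_recr /=.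
set e := x ^+ (\sum_(i < k) i)%N.
have e0 : e != 0 by apply: expf_neq0.
rewrite !exprD -/e.
have -> : y / x * z1^-1 * z2^-1 / ((z1^-1 - 1) * (z2^-1 - 1)) =
    y / ((z1 - 1) * (z2 - 1)) / x.
  have z1i' : 1 - z1 != 0 by rewrite subr_eq0 eq_sym.
  have z2i' : 1 - z2 != 0 by rewrite subr_eq0 eq_sym.
  by field; rewrite x0 z10 z20 z1n z2n !mulN1r z1i' z2i'.
rewrite [in RHS]expr_div_n; move: (_ ^+ r.+1) => T.
have xk0 := expf_neq0 k x0; have xr0 := expf_neq0 r x0.
rewrite !exprMn !(exprS _ (k + r)) !exprD (exprS x r).
move: (x ^+ k) (x ^+ r) (z1 ^+ k) (z1 ^+ r) (z2 ^+ k) (z2 ^+ r) e e0 xk0 xr0.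
move=> xk xr z1k z1r z2k z2r e e0 xk0 xr0.
move: Zk Zk1;
  move: (Z k _ _) (Z k.+1 _ _) (Zref _ _ _ z1^-1) (Zref _ _ _ z2^-1).
move=> Y0 Y1 R1 R2 Y00 Y10.
by field; rewrite x0 y0 z10 z20 e0 xk0 xr0 Y00 Y10.
Qed.

End Tilde.

(** * Nonvanishing in the field of rational functions *)

Section RationalFunctions.

Lemma ratfun_char0 : [pchar ratfun] =i pred0.
Proof.
apply/pcharf0P => n; rewrite -(rmorph_nat (@tofrac {mpoly rat[4]})) tofrac_eq0.
by rewrite -mpolyC_nat mpolyC_eq0 Num.Theory.pnatr_eq0.
Qed.

Lemma tofrac_neq0 (v : 'I_4 -> rat) (p : {mpoly rat[4]}) :
  p.@[v] != 0 -> tofrac p != 0.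
Proof.
by rewrite tofrac_eq0; apply: contraNneq => ->; rewrite meval0.
Qed.

Lemma rmorph_asm_sum (R S : comNzRingType) (f : {rmorphism R -> S}) n U :
  f (asm_sum n U) = asm_sum n (fun i j v => f (U i j v)).
Proof.
rewrite rmorph_sum; apply: eq_bigr => M _; rewrite rmorph_prod.
by apply: eq_bigr => i _; rewrite rmorph_prod.
Qed.

Definition id_asm n : 'M[asm_entry]_n := \matrix_(i, j)
  if i == j then SeqSub (isT : (1 : int) \in [:: 0; 1; -1 : int])
  else SeqSub (isT : (0 : int) \in [:: 0; 1; -1 : int]).

Lemma line_ok_delta n i (r : nat -> int) : (i < n)%N ->
  (forall j, (j < n)%N -> r j = if i == j then 1 else 0) -> line_ok false n r.
Proof.
move=> i_n rE; have eE j : (j <= n)%N -> edge false r j = (i < j)%N.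
  elim: j => // j IH j_n; rewrite /= IH ?(ltnW j_n) // rE // /update ltnS.
  by case: (ltngtP i j).
rewrite /line_ok eE // i_n andbT; apply/allP => j;
  rewrite mem_iota => /andP[_ jn].
rewrite eE ?(ltnW jn) // rE // /compatible.
by case: (ltngtP i j).
Qed.

Lemma id_asm_ASM n : id_asm n \in ASM n.
Proof.
have idE i j : (i < n)%N -> (j < n)%N ->
    entry (id_asm n) i j = if i == j then 1 else 0.
  move=> i_n j_n;
    rewrite (entryE _ (Ordinal i_n) (Ordinal j_n)) !mxE -val_eqE /=.
  by case: ifP.
rewrite inE is_asmE; apply/andP; split; apply/allP => i; rewrite mem_iota;
  move=> /andP[_ i_n]; apply: (line_ok_delta i_n) => j j_n; rewrite idE //.
by rewrite eq_sym.
Qed.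

(** With all variables set to 1 the value is the number of ASMs, and the identity matrix is one of
    them. *)
Lemma Z_neq0 n a b : Z n (indet a) (indet b) != 0.
Proof.
rewrite Z_adj ZadjE.
pose U (i j : nat) (v : vertex) : {mpoly rat[4]} :=
  'X_a ^+ is_A1 v * 'X_b ^+ is_C2 v.
have -> : asm_sum n (boundary_weight (indet a) (indet b) 1 1) =
    tofrac (asm_sum n U).
  rewrite rmorph_asm_sum; apply: eq_bigr => M _; apply: eq_bigr => i _.
  apply: eq_bigr => j _.
  by rewrite /boundary_weight !expr1n !mulr1 /U rmorphM !rmorphXn.
apply: (@tofrac_neq0 (fun=> 1)).
have -> : (asm_sum n U).@[fun=> 1] = #|ASM n|%:R.
  rewrite (rmorph_asm_sum (meval (fun=> 1))) -sumr_const.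
  apply: eq_bigr => M _; rewrite big1 // => i _; rewrite big1 // => j _.
  by rewrite /U rmorphM !rmorphXn /= !mevalXU !expr1n mulr1.
rewrite Num.Theory.pnatr_eq0 -lt0n; apply/card_gt0P.
by exists (id_asm n); apply: id_asm_ASM.
Qed.

End RationalFunctions.

Theorem corollary6 (n : nat) (hn : (2 <= n)%N) :
  let x := indet (inord 0) in
  let y := indet (inord 1) in
  let z1 := indet (inord 2) in
  let z2 := indet (inord 3) in
  Zadj n x y z1 z2 =
    Z n.-1 x y *
    (1 + \sum_(1 <= i < n)
       (y * z1 * z2 / ((z1 - 1) * (z2 - 1))) ^+ (n - i) *
       (1 + (x * (z1 - 1) * (z2 - 1) - y) * Zref i x y z1 * Zref i x y z2 /
            (y * Z i.-1 x y * Z i x y)))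
  /\
  Zadj_tilde n x y z1 z2 =
    Z n.-1 x y *
    ((x * z1 * z2) ^+ n.-1 +
     \sum_(1 <= i < n)
       (y / ((z1 - 1) * (z2 - 1))) ^+ (n - i) *
       (x ^+ i.-1 * (z1 * z2) ^+ n.-1 +
        (z1 * z2) ^+ (n - i - 1) * ((z1 - 1) * (z2 - 1) - y * z1 * z2) *
          Zref i x y z1 * Zref i x y z2 /
          (y * Z i.-1 x y * Z i x y))).
Proof.
move=> x y z1 z2.
(* A single rational point at which none of the finitely many excluded polynomials vanishes. *)
pose v (k : 'I_4) : rat := nth 0 [:: 2; 3; 5; 7] k.
have vE k : (k < 4)%N -> v (inord k) = nth 0 [:: 2; 3; 5; 7] k.
  by move=> k4; rewrite /v inordK.
have nz p : p.@[v] != 0 -> tofrac p != 0 :> ratfun by apply: tofrac_neq0.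
have x0 : x != 0 by apply: nz; rewrite mevalXU vE.
have y0 : y != 0 by apply: nz; rewrite mevalXU vE.
have z10 : z1 != 0 by apply: nz; rewrite mevalXU vE.
have z20 : z2 != 0 by apply: nz; rewrite mevalXU vE.
have eval_simpl := (mevalD, mevalN, mevalM, meval1, mevalXU, vE).
have z11 : z1 != 1.
  rewrite -subr_eq0 -tofrac1 -tofracB; apply: nz.
  by rewrite !eval_simpl.
have z21 : z2 != 1.
  rewrite -subr_eq0 -tofrac1 -tofracB; apply: nz.
  by rewrite !eval_simpl.
have h1 : 1 + z2 * (y - 1) != 0.
  rewrite -tofrac1 -tofracB -tofracM -tofracD; apply: nz.
  by rewrite !eval_simpl.
have h2 : z1 * (1 + z2 * (y - 1)) != 1 - z2.
  rewrite -subr_eq0 -tofrac1 -!tofracB -tofracM -tofracD -tofracM -tofracB.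
  by apply: nz; rewrite !eval_simpl.
have h3 : x * z2 + y - x != 0.
  rewrite -tofracM -tofracD -tofracB; apply: nz.
  by rewrite !eval_simpl.
have h4 : x * z2 + y - x != x * z1 * (z2 - 1).
  rewrite -subr_eq0 -tofrac1 -!tofracM -!tofracD -!tofracB -tofracM -tofracB.
  by apply: nz; rewrite !eval_simpl.
have Zn0 k : Z k x y != 0 by apply: Z_neq0.
clearbody x y z1 z2; case: n hn => [|m] hn; first by [].
split.
  exact: (Zadj_formula ratfun_char0 x0 y0 z10 z20 z11 z21 Zn0 m h1 h2).
exact: (Zadj_tilde_formula ratfun_char0 x0 y0 z10 z20 z11 z21 Zn0 m h3 h4).
Qed.
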